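(* Let $1<p<r<2$ and let $M$ and $N$ be Orlicz functions such that $\frac{M(t)}{t^{p}}$ is decreasing, $\frac{N(t)}{t^{r}}$ is increasing and $\frac{N(t)}{t^{2}}$ is decreasing (as functions of $t>0$). Then there is a constant $C>0$ such that for all $n\in\mathbb N$ there is a subspace $E$ of $L_1$ with $\dim(E)=n^2$ and $$d\big(E,\ell_M^n(\ell_N^n)\big)\le C .$$
   Context: An Orlicz function is a convex function $M:[0,\infty)\to[0,\infty)$ with $M(0)=0$ and $M(t)>0$ for $t>0$. Here ''increasing'' and ''decreasing'' are meant in the non-strict sense. For an Orlicz function $M$, $\ell_M^n$ is $\mathbb R^n$ with the norm $\|x\|_M=\inf\{\rho>0 : \sum_{i=1}^n M(|x_i|/\rho)\le 1\}$. The space $\ell_M^n(\ell_N^n)$ is the space of real $n\times n$ matrices $(x_{ij})_{i,j=1}^n$ with the norm $\big\| \big( \|(x_{ij})_{j=1}^n\|_N \big)_{i=1}^n \big\|_M$. $L_1$ is the usual real Banach space $L_1[0,1]$. For isomorphic Banach spaces $X,Y$, the Banach-Mazur distance is $d(X,Y)=\inf\{\|T\|\,\|T^{-1}\| : T:X\to Y \text{ an isomorphism}\}$. *)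

(* Defs.v *)
From HB Require Import structures.
From mathcomp Require Import all_boot all_order all_algebra.
From mathcomp Require Import all_classical all_reals all_analysis.
From mathcomp Require Import measurable_realfun ess_sup_inf.
From mathcomp Require Import ring lra.

Set Implicit Arguments.
Unset Strict Implicit.
Unset Printing Implicit Defensive.

Import Order.TTheory GRing.Theory Num.Theory.
Import numFieldNormedType.Exports.

Local Open Scope classical_set_scope.
Local Open Scope ring_scope.

(* MathComp-Analysis provides LspaceType (measurable functions of finite Lp norm
   modulo almost everywhere equality) as a bare type, with no algebraic
   structure. Vector operations are those of representatives. *)
Section Lspace_normedModType.
Local Open Scope quotient_scope.
Context d (T : measurableType d) (R : realType).
Variables (mu : {measure set T -> \bar R}) (p : \bar R) (p1 : (1 <= p)%E).

Local Notation ty := (LfunType mu p1).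
Local Notation L := (LspaceType mu p1).

HB.instance Definition _ := gen_eqMixin L.
HB.instance Definition _ := gen_choiceMixin L.

Lemma eq_ae_Lnorm (f g : T -> R) : measurable_fun setT f ->
  measurable_fun setT g -> (\forall x \ae mu, f x = g x) ->
  'N[mu]_p[EFin \o f]%E = 'N[mu]_p[EFin \o g]%E.
Proof.
move=> mf mg fg; rewrite unlock /Lnorm; case: p p1 => [r r1|_|//].
  congr (_ `^ _)%E; apply: ae_eq_integral => //.
  - apply: (measurableT_comp (measurable_poweR r)).
    by apply: measurableT_comp => //; exact/measurable_EFinP.
  - apply: (measurableT_comp (measurable_poweR r)).
    by apply: measurableT_comp => //; exact/measurable_EFinP.
  by apply: filterS fg => x fgx _ /=; rewrite fgx.
by case: ifPn => // _; apply: eq_ess_sup; apply: filterS fg => x /= ->.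
Qed.

Lemma Lspace_measurable (f : L) : measurable_fun setT (f : T -> R).
Proof. exact: (@measurable_funPT _ _ _ _ (repr (LebesgueSpace.sort f))). Qed.

Lemma Lspace_Lfun (f : L) : (f : T -> R) \in Lfun mu p.
Proof.
rewrite inE; apply/andP; split; rewrite inE /=; first exact: Lspace_measurable.
exact: Lebesgue_finite.
Qed.

Definition of_Lspace (f : L) : ty := Lfun_Sub p1 (Lspace_Lfun f).

Definition mfun_of_Lfun (h : ty) : {mfun T >-> measurableTypeR R} :=
  HB.pack_for {mfun T >-> measurableTypeR R} (h : T -> measurableTypeR R)
    (isMeasurableFun.Build d _ T (measurableTypeR R) h
       (@measurable_funPT _ _ _ _ h)).

Definition aeclass (h : ty) : {mfun_ mu, T >-> measurableTypeR R} :=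
  \pi_({mfun_ mu, T >-> measurableTypeR R}) (mfun_of_Lfun h).

Lemma aeclassE (h : ty) : \forall x \ae mu, (aeclass h : T -> R) x = h x.
Proof.
have /eqP : \pi_({mfun_ mu, T >-> measurableTypeR R}) (repr (aeclass h))
    = aeclass h by rewrite reprK.
by rewrite eqmodE => /asboolP; apply: filterS => x; apply.
Qed.

Lemma aeclass_fin (h : ty) : finite_norm mu p (aeclass h).
Proof.
have := Lfunction_finite p1 h; rewrite /finite_norm; congr (_ < _)%E.
apply/esym/eq_ae_Lnorm; last exact: aeclassE.
  exact: (@measurable_funPT _ _ _ _ (repr (aeclass h))).
exact: (@measurable_funPT _ _ _ _ h).
Qed.

Definition to_Lspace (h : ty) : L :=
  HB.pack_for L (aeclass h)
    (isFinLebesgue.Build d T R mu p p1 (aeclass h) (aeclass_fin h)).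

Lemma to_LspaceE (h : ty) : \forall x \ae mu, (to_Lspace h : T -> R) x = h x.
Proof. exact: aeclassE. Qed.

Lemma Lspace_aeP (f g : L) : (\forall x \ae mu, f x = g x) -> f = g.
Proof.
move=> fg; have: LebesgueSpace.sort f = LebesgueSpace.sort g.
  rewrite -[LHS]reprK -[RHS]reprK; apply/eqP; rewrite eqmodE.
  by apply/asboolP; apply: filterS fg.
case: f g {fg} => [f cf] [g cg] /= fg.
rewrite fg in cf *; congr LebesgueSpace.Pack.
case: cf cg => [[Hf]] [[Hg]]; do 2 congr (_ _).
exact: Prop_irrelevance.
Qed.

Definition Lspace_add (f g : L) := to_Lspace (of_Lspace f + of_Lspace g).
Definition Lspace_opp (f : L) := to_Lspace (- of_Lspace f).
Definition Lspace_scale (a : R) (f : L) := to_Lspace (a *: of_Lspace f).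
Definition Lspace_zero : L := to_Lspace 0.
Definition Lspace_norm (f : L) : R := fine 'N[mu]_p[EFin \o f]%E.

Lemma Lspace_addE f g : \forall x \ae mu, Lspace_add f g x = f x + g x.
Proof. exact: to_LspaceE. Qed.
Lemma Lspace_oppE f : \forall x \ae mu, Lspace_opp f x = - f x.
Proof. exact: to_LspaceE. Qed.
Lemma Lspace_scaleE a f : \forall x \ae mu, Lspace_scale a f x = a * f x.
Proof. exact: to_LspaceE. Qed.
Lemma Lspace_zeroE : \forall x \ae mu, Lspace_zero x = 0.
Proof. exact: to_LspaceE. Qed.

Lemma Lspace_addA : associative Lspace_add.
Proof.
move=> f g h; apply: Lspace_aeP.
near=> x; rewrite (near (Lspace_addE _ (Lspace_add g h)) x)//.
rewrite (near (Lspace_addE (Lspace_add f g) h) x)//.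
rewrite (near (Lspace_addE f g) x)// (near (Lspace_addE g h) x)//.
by rewrite addrA.
Unshelve. all: by end_near. Qed.

Lemma Lspace_addC : commutative Lspace_add.
Proof. by move=> f g; rewrite /Lspace_add addrC. Qed.

Lemma Lspace_add0 : left_id Lspace_zero Lspace_add.
Proof.
move=> f; apply: Lspace_aeP.
near=> x; rewrite (near (Lspace_addE _ f) x)//.
by rewrite (near Lspace_zeroE x)// add0r.
Unshelve. all: by end_near. Qed.

Lemma Lspace_addN : left_inverse Lspace_zero Lspace_opp Lspace_add.
Proof.
move=> f; apply: Lspace_aeP.
near=> x; rewrite (near (Lspace_addE _ f) x)// (near Lspace_zeroE x)//.
by rewrite (near (Lspace_oppE f) x)// addNr.
Unshelve. all: by end_near. Qed.

HB.instance Definition _ := GRing.isZmodule.Build L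
  Lspace_addA Lspace_addC Lspace_add0 Lspace_addN.

Lemma Lspace_scaleA a b f :
  Lspace_scale a (Lspace_scale b f) = Lspace_scale (a * b) f.
Proof.
apply: Lspace_aeP.
near=> x; rewrite (near (Lspace_scaleE a _) x)// (near (Lspace_scaleE b f) x)//.
by rewrite (near (Lspace_scaleE _ f) x)// mulrA.
Unshelve. all: by end_near. Qed.

Lemma Lspace_scale1 : left_id 1 Lspace_scale.
Proof.
move=> f; apply: Lspace_aeP.
by near=> x; rewrite (near (Lspace_scaleE 1 f) x)// mul1r.
Unshelve. all: by end_near. Qed.

Lemma Lspace_scaleDr : right_distributive Lspace_scale +%R.
Proof.
move=> a f g; apply: Lspace_aeP.
near=> x; rewrite (near (Lspace_scaleE a _) x)// (near (Lspace_addE f g) x)//.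
rewrite (near (Lspace_addE (Lspace_scale a f) (Lspace_scale a g)) x)//.
by rewrite !(near (Lspace_scaleE a _) x)// mulrDr.
Unshelve. all: by end_near. Qed.

Lemma Lspace_scaleDl f : {morph Lspace_scale^~ f : a b / a + b}.
Proof.
move=> a b; apply: Lspace_aeP.
near=> x; rewrite (near (Lspace_scaleE (a + b) f) x)//.
rewrite (near (Lspace_addE (Lspace_scale a f) (Lspace_scale b f)) x)//.
by rewrite (near (Lspace_scaleE a f) x)// (near (Lspace_scaleE b f) x)// mulrDl.
Unshelve. all: by end_near. Qed.

HB.instance Definition _ := GRing.Zmodule_isLmodule.Build R L
  Lspace_scaleA Lspace_scale1 Lspace_scaleDr Lspace_scaleDl.

Lemma to_Lspace_norm (h : ty) :
  Lspace_norm (to_Lspace h) = fine 'N[mu]_p[EFin \o h]%E.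
Proof.
congr fine; apply: eq_ae_Lnorm => //; last exact: to_LspaceE.
exact: Lspace_measurable.
Qed.

Lemma Lspace_normD f g :
  Lspace_norm (f + g) <= Lspace_norm f + Lspace_norm g.
Proof.
rewrite to_Lspace_norm; exact: (ler_LnormD (of_Lspace f) (of_Lspace g)).
Qed.

Lemma Lspace_normZ (a : R) f : Lspace_norm (a *: f) = `|a| * Lspace_norm f.
Proof.
rewrite to_Lspace_norm /=.
have := LnormZ (of_Lspace f) a; rewrite /= => ->.
by rewrite -(finite_norm_fine (of_Lspace f)).
Qed.

Lemma Lspace_norm0_eq0 f : Lspace_norm f = 0 -> f = 0.
Proof.
move=> /(@fine_Lnormr_eq0 _ _ _ _ _ _ (of_Lspace f)) f0; apply: Lspace_aeP.
near=> x; rewrite (near Lspace_zeroE x)//; near: x.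
by apply: filterS f0 => x; apply.
Unshelve. all: by end_near. Qed.

HB.instance Definition _ := Lmodule_isNormed.Build R L
  Lspace_normD Lspace_normZ Lspace_norm0_eq0.

End Lspace_normedModType.

(* L_1[0,1]: functions on the real line are identified when they agree almost
   everywhere on [0,1], since the measure is carried by [0,1]. *)
Definition L1 (R : realType) : normedModType R :=
  LspaceType1 (mrestr (@lebesgue_measure R)
    (measurable_itv `[0 : R, 1 : R]) : {measure set (measurableTypeR R) -> \bar R}).

Section linear_subspace.
Context (R : realType) (V : normedModType R) (E : submodClosed V).

Definition linear_subspace : Type := {x : V | x \in E}.

HB.instance Definition _ := [isSub of linear_subspace for @sval V (fun x => x \in E)].
HB.instance Definition _ := [Choice of linear_subspace by <:].
HB.instance Definition _ := [SubChoice_isSubLmodule of linear_subspace by <:].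

Definition linear_subspace_norm (x : linear_subspace) : R := `|val x|.

Lemma linear_subspace_normD x y :
  linear_subspace_norm (x + y) <= linear_subspace_norm x + linear_subspace_norm y.
Proof. by rewrite /linear_subspace_norm raddfD ler_normD. Qed.

Lemma linear_subspace_normZ (a : R) x : linear_subspace_norm (a *: x) = `|a| * linear_subspace_norm x.
Proof. by rewrite /linear_subspace_norm linearZ normrZ. Qed.

Lemma linear_subspace_norm0_eq0 x : linear_subspace_norm x = 0 -> x = 0.
Proof. by move/normr0_eq0 => x0; apply: val_inj; rewrite x0 raddf0. Qed.

HB.instance Definition _ := Lmodule_isNormed.Build R linear_subspace
  linear_subspace_normD linear_subspace_normZ linear_subspace_norm0_eq0.
End linear_subspace.


(* d-element bases: existence and uniqueness of the coordinates. *)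
Definition has_dim (K : fieldType) (V : lmodType K) (d : nat) : Prop :=
  exists b : 'I_d -> V,
    forall x : V, exists! c : {ffun 'I_d -> K}, x = \sum_(i < d) c i *: b i.

Definition opnorm (R : realType) (X Y : normedModType R) (f : X -> Y) : \bar R :=
  ereal_sup [set `|f x|%:E | x in [set x : X | `|x| <= 1]].

(* The infimum is taken in the extended reals, so that the distance between
   non-isomorphic spaces is +oo (a real-valued inf would return 0). *)
Definition banach_mazur (R : realType) (X Y : normedModType R) : \bar R :=
  ereal_inf [set k | exists (f : {linear X -> Y}) (g : {linear Y -> X}),
    [/\ cancel f g, cancel g f, continuous f, continuous g &
        k = (opnorm f * opnorm g)%E]].

(* Only the values on [0, +oo[ are constrained, and only those values enter
   the norms below. *)
Record orliczFun (R : realType) := OrliczFun {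
  orlicz_fun :> R -> R;
  orlicz_convex : convex_function (`[0, +oo[ : set R^o) orlicz_fun;
  orlicz_eq0 : orlicz_fun 0 = 0;
  orlicz_gt0 : forall t, 0 < t -> 0 < orlicz_fun t }.

Definition orlicz_norm (R : realType) (M : R -> R) n (x : 'rV[R]_n) : R :=
  inf [set rho | 0 < rho /\ \sum_(i < n) M (`|x 0 i| / rho) <= 1].

Section orlicz_norm_theory.
Context (R : realType) (M : orliczFun R).

Local Notation ball x rho := (0 < rho /\ \sum_i M (`|x 0 i| / rho) <= 1).

Lemma orlicz_ge0 t : 0 <= t -> 0 <= M t.
Proof.
by rewrite le_eqVlt => /predU1P[<-|/orlicz_gt0/ltW//]; rewrite orlicz_eq0.
Qed.

Lemma orlicz_conv (a b s t : R) : 0 <= a -> 0 <= b -> a + b = 1 ->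
  0 <= s -> 0 <= t -> M (a * s + b * t) <= a * M s + b * M t.
Proof.
move=> a0 b0 ab s0 t0.
have a01 : 0 <= a <= 1 by rewrite a0 -ab lerDl.
have : M (a * s + (1 - a) * t) <= a * M s + (1 - a) * M t.
  by apply: (@orlicz_convex _ M (Itv01 (andP a01).1 (andP a01).2) s t);
    rewrite inE/= in_itv/= ?s0 ?t0.
suff -> : 1 - a = b by []; by rewrite -ab addrC addKr.
Qed.

Lemma orlicz_scale a t : 0 <= a <= 1 -> 0 <= t -> M (a * t) <= a * M t.
Proof.
move=> /andP[a0 a1] t0; have a1' : 0 <= 1 - a by rewrite subr_ge0.
have := orlicz_conv a0 a1' _ t0 (lexx 0).
by rewrite orlicz_eq0 !mulr0 !addr0; apply; rewrite addrC subrK.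
Qed.

Lemma orlicz_le s t : 0 <= s -> s <= t -> M s <= M t.
Proof.
move=> s0; rewrite le_eqVlt => /predU1P[->//|st].
have t0 : 0 < t by exact: le_lt_trans st.
have -> : s = (s / t) * t by rewrite divfK// gt_eqF.
have h : 0 <= s / t <= 1 by rewrite divr_ge0 ?(ltW t0)//= ler_pdivrMr// mul1r ltW.
apply: (le_trans (orlicz_scale h (ltW t0))).
by rewrite -[leRHS]mul1r ler_wpM2r ?orlicz_ge0 ?(ltW t0)//; case/andP: h.
Qed.

Lemma orlicz_ball_nonempty n (x : 'rV[R]_n) : exists rho, ball x rho.
Proof.
pose S := \sum_i M `|x 0 i|.
have S0 : 0 <= S by apply: sumr_ge0 => i _; exact: orlicz_ge0.
have r0 : 0 < 1 + S by rewrite ltr_pwDl.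
exists (1 + S); split => //.
apply: (@le_trans _ _ (\sum_i (1 + S)^-1 * M `|x 0 i|)).
  apply: ler_sum => i _; rewrite mulrC; apply: orlicz_scale => //.
  by rewrite invr_ge0 (ltW r0) /= invf_le1// lerDl.
by rewrite -mulr_sumr ler_pdivrMl// mulr1 lerDr.
Qed.

Lemma orlicz_norm_ge0 n (x : 'rV[R]_n) : 0 <= orlicz_norm M x.
Proof.
apply: lb_le_inf; first exact: orlicz_ball_nonempty.
by move=> rho [/ltW].
Qed.

Lemma orlicz_norm_le n (x : 'rV[R]_n) rho : ball x rho -> orlicz_norm M x <= rho.
Proof. by move=> h; apply: ge_inf => //; exists 0 => r [/ltW]. Qed.

Lemma orlicz_norm_lt n (x : 'rV[R]_n) rho : orlicz_norm M x < rho -> ball x rho.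
Proof.
move=> /inf_lt[|s [s0 xs] sr]; first exact: orlicz_ball_nonempty.
have r0 : 0 < rho by exact: lt_trans sr.
split => //; apply: le_trans xs; apply: ler_sum => i _.
apply: orlicz_le; first by rewrite divr_ge0// ltW.
by rewrite ler_wpM2l// lef_pV2 ?posrE// ltW.
Qed.

Lemma orlicz_norm_subadd n (x y z : 'rV[R]_n) :
  (forall i, `|z 0 i| <= `|x 0 i| + `|y 0 i|) ->
  orlicz_norm M z <= orlicz_norm M x + orlicz_norm M y.
Proof.
move=> zxy; apply/ler_addgt0Pr => e e0.
have e2 : 0 < e / 2 by rewrite divr_gt0.
pose a := orlicz_norm M x + e / 2; pose b := orlicz_norm M y + e / 2.
have [a0 xa] : ball x a by apply: orlicz_norm_lt; rewrite ltrDl.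
have [b0 yb] : ball y b by apply: orlicz_norm_lt; rewrite ltrDl.
have ab0 : 0 < a + b by rewrite addr_gt0.
have -> : orlicz_norm M x + orlicz_norm M y + e = a + b by rewrite /a /b; field.
apply: orlicz_norm_le; split => //.
pose p := a / (a + b); pose q := b / (a + b).
have p0 : 0 <= p by rewrite divr_ge0// ltW.
have q0 : 0 <= q by rewrite divr_ge0// ltW.
have pq : p + q = 1 by rewrite /p /q -mulrDl divff// gt_eqF.
apply: (@le_trans _ _ (\sum_i (p * M (`|x 0 i| / a) + q * M (`|y 0 i| / b)))).
  apply: ler_sum => i _.
  apply: le_trans (orlicz_conv p0 q0 pq _ _); last 2 first.
  - by rewrite divr_ge0// ltW.
  - by rewrite divr_ge0// ltW.
  apply: orlicz_le; first by rewrite divr_ge0// ltW.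
  have -> : p * (`|x 0 i| / a) + q * (`|y 0 i| / b) = (`|x 0 i| + `|y 0 i|) / (a + b).
    by rewrite /p /q; field; rewrite !gt_eqF.
  by rewrite ler_wpM2r ?invr_ge0 ?(ltW ab0).
rewrite big_split /= -!mulr_sumr -pq.
by apply: lerD; rewrite -[leRHS]mulr1 ler_wpM2l.
Qed.

Lemma orlicz_norm_eq0 n (x : 'rV[R]_n) : (forall i, x 0 i = 0) -> orlicz_norm M x = 0.
Proof.
move=> x0; apply/le_anti; rewrite orlicz_norm_ge0 andbT.
apply/ler_addgt0Pr => e e0; rewrite add0r; apply: orlicz_norm_le; split => //.
by rewrite big1// => i _; rewrite x0 normr0 mul0r orlicz_eq0.
Qed.

Lemma orlicz_normM_le n (x z : 'rV[R]_n) a : 0 < a ->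
  (forall i, `|z 0 i| = a * `|x 0 i|) ->
  orlicz_norm M z <= a * orlicz_norm M x.
Proof.
move=> a0 zx; rewrite -ler_pdivrMl//.
apply: lb_le_inf; first exact: orlicz_ball_nonempty.
move=> r [r0 xr]; rewrite ler_pdivrMl//; apply: orlicz_norm_le.
split; first by rewrite mulr_gt0.
apply: le_trans xr; apply: ler_sum => i _.
by rewrite zx -mulf_div divff ?gt_eqF// mul1r.
Qed.

Lemma orlicz_normM n (x z : 'rV[R]_n) a : 0 <= a ->
  (forall i, `|z 0 i| = a * `|x 0 i|) ->
  orlicz_norm M z = a * orlicz_norm M x.
Proof.
rewrite le_eqVlt => /predU1P[<- zx|a0 zx].
  rewrite mul0r orlicz_norm_eq0// => i.
  by apply/normr0_eq0; rewrite zx mul0r.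
apply/le_anti; rewrite orlicz_normM_le//= -ler_pdivlMl//.
apply: orlicz_normM_le; first by rewrite invr_gt0.
by move=> i; rewrite zx mulKf// gt_eqF.
Qed.

Lemma orlicz_norm0_eq0 n (x : 'rV[R]_n) :
  orlicz_norm M x = 0 -> forall i, x 0 i = 0.
Proof.
move=> x0 i; apply/eqP; apply: contraT => xi0.
have t0 : 0 < `|x 0 i| by rewrite normr_gt0.
set t := `|x 0 i| in t0.
have Mt := orlicz_gt0 M t0.
pose k := 1 + 2 / M t.
have h : 0 < 2 / M t by rewrite divr_gt0.
have k1 : 1 <= k by rewrite lerDl ltW.
have k0 : 0 < k by exact: lt_le_trans k1.
have [_ xk] : ball x k^-1 by apply: orlicz_norm_lt; rewrite x0 invr_gt0.
have : M (t / k^-1) <= 1.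
  apply: le_trans xk; rewrite (bigD1 i)//= lerDl sumr_ge0// => j _.
  by apply: orlicz_ge0; rewrite divr_ge0// invr_ge0 ltW.
rewrite invrK leNgt => /negP; case.
have := @orlicz_scale k^-1 (t * k) _ _.
rewrite invr_ge0 (ltW k0) /= invf_le1// k1 mulr_ge0 ?(ltW t0) ?(ltW k0)//.
move=> /(_ isT isT); rewrite mulrCA mulVf ?gt_eqF// mulr1 ler_pdivlMl//.
apply: lt_le_trans; rewrite /k mulrDl mul1r divfK ?gt_eqF//.
by lra.
Qed.
End orlicz_norm_theory.

(* The space l_M^n(l_N^n); an alias of 'M[R]_n, to avoid the sup norm that the
   library puts on matrices. *)
Definition orlicz_mx (R : realType) (M N : orliczFun R) (n : nat) : Type :=
  'M[R]_n.

Section orlicz_mx.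
Context (R : realType) (M N : orliczFun R) (n : nat).

Local Notation orlicz_mx := (orlicz_mx M N n).

HB.instance Definition _ := GRing.Lmodule.copy orlicz_mx 'M[R]_n.

Definition orlicz_mx_norm (A : orlicz_mx) : R :=
  orlicz_norm M (\row_i orlicz_norm N (row i (A : 'M[R]_n))).

Lemma orlicz_mx_normD A B :
  orlicz_mx_norm (A + B) <= orlicz_mx_norm A + orlicz_mx_norm B.
Proof.
apply: orlicz_norm_subadd => i; rewrite !mxE !ger0_norm ?orlicz_norm_ge0//.
by apply: orlicz_norm_subadd => j; rewrite !mxE ler_normD.
Qed.

Lemma orlicz_mx_normZ (a : R) A : orlicz_mx_norm (a *: A) = `|a| * orlicz_mx_norm A.
Proof.
apply: orlicz_normM => // i; rewrite !mxE.
rewrite (ger0_norm (orlicz_norm_ge0 N (row i (a *: (A : 'M[R]_n))))).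
rewrite (ger0_norm (orlicz_norm_ge0 N (row i (A : 'M[R]_n)))).
have -> : (row i (a *: (A : 'M[R]_n))) = a *: row i (A : 'M[R]_n) by apply/rowP => j; rewrite !mxE.
by apply: orlicz_normM => // j; rewrite !mxE normrM.
Qed.

Lemma orlicz_mx_norm0_eq0 A : orlicz_mx_norm A = 0 -> A = 0.
Proof.
move=> /orlicz_norm0_eq0 A0; apply/matrixP => i j.
have := A0 i; rewrite mxE => /orlicz_norm0_eq0/(_ j).
by rewrite !mxE.
Qed.

HB.instance Definition _ := Lmodule_isNormed.Build R orlicz_mx
  orlicz_mx_normD orlicz_mx_normZ orlicz_mx_norm0_eq0.

End orlicz_mx.

(* Main.v *)
From HB Require Import structures.
Require Import Defs.
From mathcomp Require Import all_boot all_order all_algebra.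
From mathcomp Require Import all_classical all_reals all_analysis.
From mathcomp Require Import measurable_realfun.
From mathcomp Require Import ring lra.

Set Implicit Arguments.
Unset Strict Implicit.
Unset Printing Implicit Defensive.

Import Order.TTheory GRing.Theory Num.Theory.
Import numFieldNormedType.Exports.

Local Open Scope classical_set_scope.
Local Open Scope ring_scope.

(** The space l_M^n(l_N^n) is realized as a tensor product of two families of
    random variables on finite probability spaces.  Suppose that random
    variables y_i and x_j satisfy, with constants that do not depend on n,
    - E|sum_i a_i y_i| ~ ||a||_M, and
    - E|sum_j b_j x_j| ~ (E|sum_j b_j x_j|^p)^(1/p) ~ ||b||_N.
    On the product space, A |-> sum_ij A_ij y_i (x) x_j is then an isomorphic
    embedding into L_1.  Put f_i = sum_j A_ij x_j and b_i = ||row i A||_N.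
    Integrating first in the y variables gives the norm of A in L_1 as
    E ||(f_i)_i||_M up to constants.  It is at least ||(E|f_i|)_i||_M by the
    triangle inequality ([tensor_lower]).  It is at most a constant times
    ||b||_M because M(u) <= M(v)(1 + (u/v)^p), which bounds E M(|f_i|) by a
    multiple of M(b_i) as soon as E|f_i|^p is controlled by b_i^p
    ([tensor_upper]).  This is the only place where the p-concavity of M meets
    the integrability exponent p < r of the system for N.

    The variables are y_i = eps_i * s_i with independent signs eps_i and
    independent copies s_i of one variable with values in the dyadic scales
    2^k, 0 <= k <= K, or 0 ([gauge_orlicz_system]).  For such sums the norm is
    read off from H_q(t) = E huber_q(t s), where huber_q is t^2 near 0 and t^q
    near infinity: a bound on sum_i H_q(|a_i|) controls the q-th moment
    ([rad_upper]), and a bound on the first moment controls sum_i H_1(|a_i|)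
    ([khintchine] and [square_lower]).

    It remains to choose the law of s so that H_1 (for M), respectively both
    H_1 and H_p (for N), is equivalent to the given Orlicz function on
    [2^-K, 1]; with 2^K >= n, smaller coordinates are negligible.  If the
    function is p-concave with p < 2, the scales 2^k above 1/t reproduce it
    exactly by a telescoping sum and the other scales form a geometric series
    ([gauge_concave]); if it is r-convex with q < r and 2-concave, the roles of
    the two ranges of scales are exchanged ([gauge_convex]).

    Finite l_1 spaces sit isometrically in L_1[0,1] as spans of normalized
    indicators of disjoint intervals ([L1_contains_l1]), which turns the finite
    embedding into a subspace of L_1. *)

(** * Product weights and Rademacher sums *)

Section product_weights.
Context (R : realType) (I S : finType) (mu : S -> R).
Hypothesis mu1 : \sum_s mu s = 1.

Definition prodw (w : {ffun I -> S}) : R := \prod_i mu (w i).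

Definition upd (w : {ffun I -> S}) (i : I) (s : S) : {ffun I -> S} :=
  [ffun j => if j == i then s else w j].

Lemma sum_prodw : \sum_w prodw w = 1.
Proof.
rewrite /prodw -(bigA_distr_bigA (fun (_ : I) s => mu s)).
by rewrite big1.
Qed.

Lemma prodw_upd w i s : prodw (upd w i s) * mu (w i) = prodw w * mu s.
Proof.
rewrite /prodw (bigD1 i)//= [in RHS](bigD1 i)//= ffunE eqxx.
rewrite (eq_bigr (fun j => mu (w j))); first by ring.
by move=> j ji; rewrite ffunE (negPf ji).
Qed.

(** Independence of the coordinate i from the others.  Resampling coordinate i
    with a fresh value exchanges the old and the new value, an involution that
    preserves the product weight and does not affect F. *)
Lemma prodw_indep i (phi : S -> R) (F : {ffun I -> S} -> R) :
  (forall w s, F (upd w i s) = F w) ->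
  \sum_w prodw w * (phi (w i) * F w) =
  (\sum_s mu s * phi s) * \sum_w prodw w * F w.
Proof.
move=> Fi; pose h (x : {ffun I -> S} * S) := (upd x.1 i x.2, x.1 i).
have hK : involutive h.
  move=> [w s]; rewrite /h/=; congr pair; last by rewrite ffunE eqxx.
  by apply/ffunP => j; rewrite !ffunE; case: eqP => // ->.
rewrite mulrC big_distrlr/= pair_bigA/= (reindex_inj (inv_inj hK))/=.
rewrite -(pair_bigA _ (fun w s => prodw (upd w i s) * F (upd w i s) *
  (mu (w i) * phi (w i))))/=.
apply: eq_bigr => w _.
transitivity (\sum_s mu s * (prodw w * (phi (w i) * F w))).
  by rewrite -mulr_suml mu1 mul1r.
apply: eq_bigr => s _; rewrite Fi.
transitivity ((prodw w * mu s) * (phi (w i) * F w)); first by ring.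
by rewrite -(prodw_upd w i s); ring.
Qed.

Lemma prodw_marginal i (phi : S -> R) :
  \sum_w prodw w * phi (w i) = \sum_s mu s * phi s.
Proof.
have := @prodw_indep i phi (fun=> 1) (fun _ _ => erefl).
under eq_bigr do rewrite mulr1.
move=> ->; under [X in _ * X]eq_bigr do rewrite mulr1.
by rewrite sum_prodw mulr1.
Qed.

Hypothesis mu0 : forall s, 0 <= mu s.

Lemma prodw_ge0 w : 0 <= prodw w.
Proof. by apply: prodr_ge0. Qed.

End product_weights.

Section rademacher.
Context (R : realType) (I : finType).
Implicit Types (e : {ffun I -> bool}) (a : I -> R).

Definition radw e : R := prodw (fun=> 2^-1) e.

Definition radsum (r : seq I) a e : R := \sum_(i <- r) (-1) ^+ (e i) * a i.

Lemma sum_bool_half : \sum_(b : bool) (2^-1 : R) = 1.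
Proof. by rewrite big_bool/=; lra. Qed.

Lemma sum_radw : \sum_e radw e = 1.
Proof. exact/sum_prodw/sum_bool_half. Qed.

Lemma radw_ge0 e : 0 <= radw e.
Proof. by apply: prodw_ge0 => s; rewrite invr_ge0. Qed.

Lemma radw_sign i (F : {ffun I -> bool} -> R) :
  (forall e s, F (upd e i s) = F e) ->
  \sum_e radw e * ((-1) ^+ (e i) * F e) = 0.
Proof.
move=> Fi; rewrite /radw (prodw_indep sum_bool_half (fun b => (-1) ^+ b) Fi).
by rewrite big_bool /= expr1 expr0; ring.
Qed.

Lemma radsum_upd r a i : i \notin r ->
  forall e s, radsum r a (upd e i s) = radsum r a e.
Proof.
move=> ir e s; apply: eq_big_seq => j jr; rewrite ffunE.
by case: eqP => // ji; rewrite -ji jr in ir.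
Qed.

(** Both moments are obtained together, one sign at a time: the cross terms of
    odd degree in the new sign vanish, and the second moment enters the
    expansion of the fourth. *)
Lemma rad_moments r a : uniq r ->
  \sum_e radw e * radsum r a e ^+ 2 = \sum_(i <- r) a i ^+ 2 /\
  \sum_e radw e * radsum r a e ^+ 4 <= 3 * (\sum_(i <- r) a i ^+ 2) ^+ 2.
Proof.
elim: r => [_|i r IH /= /andP[ir ur]].
  have r0 e : radsum [::] a e = 0 by rewrite /radsum big_nil.
  rewrite !big_nil expr0n mulr0.
  by split; rewrite big1// => e _; rewrite r0 expr0n mulr0.
have [IH2 IH4] := IH ur.
have key (k : nat) :
    \sum_e radw e * ((-1) ^+ (e i) * radsum r a e ^+ k) = 0.
  by apply: radw_sign => e s; rewrite radsum_upd.
have key1 : \sum_e radw e * ((-1) ^+ (e i) * radsum r a e) = 0.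
  by apply: radw_sign => e s; rewrite radsum_upd.
have sgn2 e : ((-1) ^+ (e i) : R) ^+ 2 = 1 by rewrite sqrr_sign.
set A := \sum_(i <- r) a i ^+ 2 in IH2 IH4 *.
rewrite big_cons -/A; split.
  transitivity (\sum_e (radw e * a i ^+ 2 +
     2 * a i * (radw e * ((-1) ^+ (e i) * radsum r a e)) +
     radw e * radsum r a e ^+ 2)).
    apply: eq_bigr => e _; rewrite /radsum big_cons -/(radsum r a e).
    by rewrite sqrrD exprMn sgn2; ring.
  rewrite !big_split/= -mulr_suml sum_radw mul1r -mulr_sumr key1 IH2.
  by rewrite mulr0 addr0.
have -> : \sum_e radw e * radsum (i :: r) a e ^+ 4 =
    a i ^+ 4 + 6 * a i ^+ 2 * A + \sum_e radw e * radsum r a e ^+ 4.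
  transitivity (\sum_e (radw e * a i ^+ 4 +
     4 * a i ^+ 3 * (radw e * ((-1) ^+ (e i) * radsum r a e)) +
     6 * a i ^+ 2 * (radw e * radsum r a e ^+ 2) +
     4 * a i * (radw e * ((-1) ^+ (e i) * radsum r a e ^+ 3)) +
     radw e * radsum r a e ^+ 4)).
    apply: eq_bigr => e _; rewrite /radsum big_cons -/(radsum r a e).
    have := sgn2 e; move: (_ ^+ e i) => s s2.
    have s3 : s ^+ 3 = s by rewrite exprS s2 mulr1.
    have s4 : s ^+ 4 = 1 by rewrite (exprM s 2 2) s2 expr1n.
    transitivity (radw e * (s ^+ 4 * a i ^+ 4 + 4 * s ^+ 3 * a i ^+ 3 * radsum r a e
      + 6 * s ^+ 2 * a i ^+ 2 * radsum r a e ^+ 2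
      + 4 * s * a i * radsum r a e ^+ 3 + radsum r a e ^+ 4)); first by ring.
    by rewrite s2 s3 s4; ring.
  rewrite !big_split/= -mulr_suml sum_radw mul1r.
  rewrite -(mulr_sumr _ _ _ (4 * a i ^+ 3)) -(mulr_sumr _ _ _ (6 * a i ^+ 2)).
  by rewrite -(mulr_sumr _ _ _ (4 * a i)) key key1 IH2; ring.
apply: (@le_trans _ _ (a i ^+ 4 + 6 * a i ^+ 2 * A + 3 * A ^+ 2)); first by rewrite lerD2l.
rewrite -subr_ge0.
have -> : 3 * (a i ^+ 2 + A) ^+ 2 - (a i ^+ 4 + 6 * a i ^+ 2 * A + 3 * A ^+ 2) =
  2 * (a i ^+ 2) ^+ 2 by ring.
by rewrite mulr_ge0// sqr_ge0.
Qed.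

Definition radS a e : R := \sum_i (-1) ^+ (e i) * a i.

Lemma rad2 a : \sum_e radw e * radS a e ^+ 2 = \sum_i a i ^+ 2.
Proof. by have [] := rad_moments a (index_enum_uniq I). Qed.

Lemma rad4 a : \sum_e radw e * radS a e ^+ 4 <= 3 * (\sum_i a i ^+ 2) ^+ 2.
Proof. by have [] := rad_moments a (index_enum_uniq I). Qed.

(** Comparison of the first and the second moment: |x| is bounded below by a
    combination of x^2 and - x^4, whose means are controlled by [rad2] and
    [rad4]. *)
Lemma khintchine a :
  Num.sqrt (\sum_i a i ^+ 2) <= 2 * \sum_e radw e * `|radS a e|.
Proof.
set A := \sum_i a i ^+ 2; have A0 : 0 <= A by apply: sumr_ge0 => i _; exact: sqr_ge0.
have [s0|s0] := eqVneq (Num.sqrt A) 0.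
  by rewrite s0 mulr_ge0// sumr_ge0// => e _; rewrite mulr_ge0// radw_ge0.
set s := Num.sqrt A in s0 *.
have {}s0 : 0 < s by rewrite lt0r s0 sqrtr_ge0.
have s2 : s ^+ 2 = A by rewrite sqr_sqrtr.
have s4 : s ^+ 4 = A ^+ 2 by rewrite -s2; ring.
(* With y = |x| / s this reads 1 - y + (4/27) y^3 >= 0, where the left-hand side
   is (1/27) (2 y - 3)^2 (y + 3): the constant 4/27 is the one that gives a double root. *)
have pt (x : R) : 27 * (x ^+ 2 * s ^+ 2) - 4 * x ^+ 4 <= 27 * (`|x| * s ^+ 3).
  rewrite -(real_normK (num_real x)).
  have -> : x ^+ 4 = `|x| ^+ 4 by rewrite !(exprM _ 2 2) real_normK ?num_real.
  have := normr_ge0 x; move: `|x| => y y0; rewrite -subr_ge0.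
  have -> : 27 * (y * s ^+ 3) - (27 * (y ^+ 2 * s ^+ 2) - 4 * y ^+ 4) =
    y * ((2 * y - 3 * s) ^+ 2 * (y + 3 * s)) by ring.
  by apply: mulr_ge0 => //; apply: mulr_ge0; [exact: sqr_ge0|lra].
have : \sum_e radw e * (27 * (radS a e ^+ 2 * s ^+ 2) - 4 * radS a e ^+ 4) <=
       \sum_e radw e * (27 * (`|radS a e| * s ^+ 3)).
  by apply: ler_sum => e _; rewrite ler_wpM2l ?radw_ge0.
have -> : \sum_e radw e * (27 * (`|radS a e| * s ^+ 3)) =
    27 * s ^+ 3 * \sum_e radw e * `|radS a e|.
  by rewrite mulr_sumr; apply: eq_bigr => e _; ring.
have -> : \sum_e radw e * (27 * (radS a e ^+ 2 * s ^+ 2) - 4 * radS a e ^+ 4) =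
    27 * s ^+ 2 * (\sum_e radw e * radS a e ^+ 2) - 4 * \sum_e radw e * radS a e ^+ 4.
  rewrite !mulr_sumr -sumrB; apply: eq_bigr => e _; ring.
rewrite rad2 -/A -s2; have := rad4 a; rewrite -/A -s4.
set X4 := \sum_e _ => h4; set X1 := \sum_e _ => h.
have : s ^+ 3 * (15 * s) <= s ^+ 3 * (27 * X1).
  have e1 : 27 * s ^+ 2 * s ^+ 2 = 27 * s ^+ 4 by ring.
  have e2 : s ^+ 3 * (15 * s) = 15 * s ^+ 4 by ring.
  have e3 : s ^+ 3 * (27 * X1) = 27 * s ^+ 3 * X1 by ring.
  rewrite e2 e3; rewrite e1 in h; lra.
rewrite ler_pM2l ?exprn_gt0// => h'.
lra.
Qed.

End rademacher.

(** * Moments of random signs with large and small coefficients *)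

Section young_function.
Context (R : realType).
Implicit Types (q s t : R).

(** Orlicz function of L_2 + L_q type, equivalent to the Huber loss when q = 1.
    It is the one that governs sums of independent symmetric variables in L_q
    when q <= 2. *)
Definition huber q t : R := if t <= 1 then t ^+ 2 else t `^ q.

Lemma huber_ge0 q t : 0 <= huber q t.
Proof. by rewrite /huber; case: ifP => _; rewrite ?sqr_ge0 ?powR_ge0. Qed.

Lemma huber0 q : huber q 0 = 0.
Proof. by rewrite /huber ler01 expr0n. Qed.

Lemma huber_ge1 q t : 1 <= t -> huber q t = t `^ q.
Proof.
move=> t1; rewrite /huber; case: ifP => // t1'.
have -> : t = 1 by apply/le_anti; rewrite t1 t1'.
by rewrite expr1n powR1.
Qed.

Lemma huber_le1 q t : t <= 1 -> huber q t = t ^+ 2.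
Proof. by rewrite /huber => ->. Qed.

Lemma huber_le q s t : 0 <= q -> 0 <= s -> s <= t -> huber q s <= huber q t.
Proof.
move=> q0 s0 st; have t0 := le_trans s0 st.
have [t1|/ltW t1] := leP t 1.
  by rewrite !huber_le1//; [rewrite lerXn2r | exact: le_trans t1].
rewrite (huber_ge1 _ t1); have [s1|/ltW s1] := leP s 1.
  rewrite huber_le1//; apply: (@le_trans _ _ 1); first by rewrite expr_le1.
  by rewrite -(powRr0 t) ler_powR.
by rewrite huber_ge1// ge0_ler_powR.
Qed.

Lemma huber_double q t : 0 <= q <= 2 -> 0 <= t -> huber q (2 * t) <= 4 * huber q t.
Proof.
move=> /andP[q0 q2] t0; have e : (2 * t) ^+ 2 = 4 * t ^+ 2 by ring.
have sq (u : R) : 1 <= u -> u `^ q <= u ^+ 2.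
  move=> u1; rewrite -powR_mulrn ?(le_trans ler01)//.
  by rewrite ler_powR.
have [t1|/ltW t1] := leP (2 * t) 1.
  by rewrite !huber_le1 ?e//; lra.
rewrite (huber_ge1 _ t1); have [t1'|/ltW t1'] := leP t 1.
  by rewrite huber_le1// -e sq.
rewrite huber_ge1// powRM// ler_wpM2r ?powR_ge0//.
have -> : (4 : R) = 2 ^+ 2 by ring.
by rewrite sq// ler1n.
Qed.

Lemma huber_scale q t s : 1 <= t -> s = 0 \/ 1 <= s ->
  huber q (t * s) = t `^ q * huber q s.
Proof.
move=> t1 [->|s1]; first by rewrite mulr0 huber0 mulr0.
have t0 := le_trans ler01 t1; have s0 := le_trans ler01 s1.
by rewrite !huber_ge1// ?powRM// -[1]mulr1 ler_pM.
Qed.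

Lemma huber1_le_sqr t : 0 <= t -> huber 1 t <= t ^+ 2.
Proof.
move=> t0; have [t1|/ltW t1] := leP t 1; first by rewrite huber_le1.
by rewrite huber_ge1// powRr1// expr2 ler_peMl.
Qed.

Lemma huber1_le_id t : 0 <= t -> huber 1 t <= t.
Proof.
move=> t0; have [t1|/ltW t1] := leP t 1; last by rewrite huber_ge1// powRr1.
by rewrite huber_le1// expr2 ler_piMl.
Qed.

Lemma powR_le_add1 q t : 0 <= q <= 2 -> 0 <= t -> t `^ q <= 1 + t ^+ 2.
Proof.
move=> /andP[q0 q2] t0; have [t1|/ltW t1] := leP t 1.
  have : t `^ q <= 1.
    have <- : 1 `^ q = 1 :> R by rewrite powR1.
    by rewrite ge0_ler_powR// nnegrE.
  by have := sqr_ge0 t; lra.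
have : t `^ q <= t `^ 2%:R by rewrite ler_powR.
by rewrite powR_mulrn//; lra.
Qed.

(** The q-th moment of a random sign sum is of order (sum g_i^2)^(q/2).  With
    V = 1 + sum huber_q |g_i| one has sum g_i^2 <= V^(2/q): coefficients below 1
    are harmless, and those above 1 are at most V^(1/q), so that
    g^2 <= |g|^q V^(2/q - 1). *)
Lemma rad_upper (I : finType) q (g : I -> R) : 1 <= q <= 2 ->
  \sum_e radw R e * `|radS g e| `^ q <= 2 * (1 + \sum_i huber q `|g i|).
Proof.
move=> /andP[q1 q2]; have q0 : 0 < q by exact: lt_le_trans q1.
set P := \sum_i huber _ _; have P0 : 0 <= P by apply: sumr_ge0 => i _; exact: huber_ge0.
set V := 1 + P; have V1 : 1 <= V by rewrite lerDl.
have V0 : 0 < V by exact: lt_le_trans V1.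
(* L is the scale of the sum: |x|^q is compared to V (1 + (x / L)^2). *)
pose L := V `^ q^-1; have L0 : 0 < L by exact: powR_gt0.
have Lq : L `^ q = V by rewrite -powRrM mulVf ?gt_eqF// powRr1// ltW.
have L1 : 1 <= L by rewrite -(powRr0 V) ler_powR// invr_ge0 ltW.
have Vsq : V <= L ^+ 2.
  by rewrite -Lq -(powR_mulrn 2 (ltW L0)) ler_powR.
have gsq i : g i ^+ 2 * V <= huber q `|g i| * L ^+ 2.
  have [g1|/ltW g1] := leP `|g i| 1.
    by rewrite huber_le1// real_normK ?num_real// ler_wpM2l// sqr_ge0.
  rewrite huber_ge1// -real_normK ?num_real//.
  have gV : `|g i| `^ q <= V.
    rewrite -huber_ge1// /V /P (bigD1 i)//= addrCA lerDl addr_ge0//.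
    by apply: sumr_ge0 => j _; exact: huber_ge0.
  have gL : `|g i| <= L.
    rewrite leNgt; apply/negP => /(gt0_ltr_powR q0); rewrite !nnegrE ltW// normr_ge0.
    by move=> /(_ isT isT); rewrite Lq ltNge gV.
  have split (u : R) : 0 < u -> u ^+ 2 = u `^ q * u `^ (2 - q).
    move=> u0; rewrite -powRD; last by rewrite (gt_eqF u0) implybT.
    by rewrite (addrC q) subrK powR_mulrn// ltW.
  rewrite (split L)// (split `|g i|) ?(lt_le_trans ltr01)// Lq.
  rewrite -mulrA ler_wpM2l ?powR_ge0// mulrC ler_wpM2l ?(ltW V0)//.
  by rewrite ge0_ler_powR ?nnegrE ?subr_ge0 ?(ltW L0).
have gL : \sum_i g i ^+ 2 <= L ^+ 2.
  rewrite -(ler_pM2r V0) mulr_suml.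
  apply: (@le_trans _ _ (P * L ^+ 2)).
    by rewrite mulr_suml; apply: ler_sum => i _.
  by rewrite mulrC ler_wpM2l ?sqr_ge0// /V lerDr.
apply: (@le_trans _ _ (\sum_e radw R e * (V * (1 + radS g e ^+ 2 / L ^+ 2)))).
  apply: ler_sum => e _; rewrite ler_wpM2l ?radw_ge0//.
  rewrite -[radS g e in leLHS](divfK (lt0r_neq0 L0)) normrM (gtr0_norm L0).
  rewrite powRM ?(ltW L0)// Lq mulrC ler_wpM2l ?(ltW V0)//.
  rewrite -expr_div_n -(real_normK (num_real (_ / L))).
  by apply: powR_le_add1; rewrite // (ltW q0) q2.
have -> : \sum_e radw R e * (V * (1 + radS g e ^+ 2 / L ^+ 2)) =
    V * (1 + (\sum_i g i ^+ 2) / L ^+ 2).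
  transitivity (\sum_e (V * radw R e + V / L ^+ 2 * (radw R e * radS g e ^+ 2))).
    by apply: eq_bigr => e _; ring.
  rewrite big_split/= -(mulr_sumr _ _ _ V) -(mulr_sumr _ _ _ (V / L ^+ 2)).
  by rewrite sum_radw rad2; ring.
rewrite mulrC ler_wpM2r ?(ltW V0)// -[2]/(1 + 1) lerD2l.
by rewrite ler_pdivrMr ?mul1r// exprn_gt0.
Qed.

End young_function.

Section square_function.
Context (R : realType) (I S : finType) (mu sc : S -> R).
Hypotheses (mu1 : \sum_s mu s = 1) (mu0 : forall s, 0 <= mu s).

(** Only coefficients whose companions are small are counted.  If the whole
    square function is at most 8, then huber 1 |g| <= g^2 does it; otherwise at
    most one index can be counted, the one that carries most of the square
    function. *)
Lemma sum_huber_isolated_le (g : I -> R) :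
  \sum_i huber 1 `|g i| * (\sum_(j | j != i) g j ^+ 2 <= 16)%R%:R <=
  8 * Num.sqrt (\sum_i g i ^+ 2).
Proof.
have G0 (P : pred I) : 0 <= \sum_(i | P i) g i ^+ 2.
  by apply: sumr_ge0 => i _; exact: sqr_ge0.
set A := \sum_i g i ^+ 2; have A0 : 0 <= A := G0 xpredT.
have sA : Num.sqrt A ^+ 2 = A by rewrite sqr_sqrtr.
have s0 := sqrtr_ge0 A.
have DA i : A = g i ^+ 2 + \sum_(j | j != i) g j ^+ 2 by rewrite /A (bigD1 i).
have [A64|A64] := leP A 64.
  apply: (@le_trans _ _ A).
    apply: ler_sum => i _; apply: (@le_trans _ _ (huber 1 `|g i|)).
      by rewrite ler_piMr ?huber_ge0// lern1 leq_b1.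
    by rewrite -real_normK ?num_real// huber1_le_sqr.
  rewrite -[leLHS]sA expr2 ler_wpM2r//.
  by rewrite -(ler_pXn2r (n := 2))// ?nnegrE// sA; lra.
have [/existsP[i Hi]|/existsPn none] := boolP [exists i, \sum_(j | j != i) g j ^+ 2 <= 16].
  rewrite (bigD1 i)//= Hi mulr1 big1 ?addr0.
    apply: (le_trans (huber1_le_id (normr_ge0 _))).
    apply: (@le_trans _ _ (Num.sqrt A)); last lra.
    by rewrite -sqrtr_sqr ler_wsqrtr// (DA i) lerDl.
  move=> k ki; rewrite (_ : (_ <= _) = false) ?mulr0//; apply/negbTE.
  rewrite -ltNge; apply: (@lt_le_trans _ _ (g i ^+ 2)).
    by have := DA i; lra.
  by rewrite (bigD1 i) 1?eq_sym//= lerDl.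
rewrite big1 ?mulr_ge0// => i _.
by rewrite (negbTE (none i)) mulr0.
Qed.

(** A small mean of the square function bounds the sum of the truncated moments.
    For each i the square function of the other coordinates is at most 4 with
    probability at least 3/4 by Markov's inequality, and this event is
    independent of coordinate i.  Inserting its indicator thus costs a factor
    4/3, after which [sum_huber_isolated_le] applies pointwise. *)
Lemma square_lower (a : I -> R) :
  \sum_w prodw mu w * Num.sqrt (\sum_i (a i * sc (w i)) ^+ 2) <= 1 ->
  \sum_i \sum_s mu s * huber 1 `|a i * sc s| <= 11.
Proof.
set T := fun w : {ffun I -> S} => Num.sqrt (\sum_i (a i * sc (w i)) ^+ 2).
move=> ET; pose F i (w : {ffun I -> S}) : R :=
  (\sum_(j | j != i) (a j * sc (w j)) ^+ 2 <= 16)%R%:R.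
have pw0 (w : {ffun I -> S}) : 0 <= prodw mu w by exact: prodw_ge0.
have T0 w : 0 <= T w by exact: sqrtr_ge0.
have F34 i : 3 <= 4 * \sum_w prodw mu w * F i w.
  have : \sum_w prodw mu w * (1 - T w / 4) <= \sum_w prodw mu w * F i w.
    apply: ler_sum => w _; rewrite ler_wpM2l// /F.
    case: (leP (\sum_(j | j != i) _) 16) => h /=; first by have := T0 w; lra.
    suff : 4 <= T w by rewrite mulr0n; lra.
    have -> : 4 = Num.sqrt (16 : R).
      have -> : (16 : R) = 4 ^+ 2 by ring.
      by rewrite sqrtr_sqr ger0_norm.
    rewrite /T ler_wsqrtr// (bigD1 i)//=; apply: (le_trans (ltW h)).
    by rewrite lerDr sqr_ge0.
  have -> : \sum_w prodw mu w * (1 - T w / 4) = 1 - (\sum_w prodw mu w * T w) / 4.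
    transitivity (\sum_w (prodw mu w - prodw mu w * T w / 4)).
      by apply: eq_bigr => w _; ring.
    by rewrite sumrB sum_prodw// mulr_suml.
  by move: ET; lra.
suff : 3 * \sum_i \sum_s mu s * huber 1 `|a i * sc s| <= 4 * 8 by lra.
apply: (@le_trans _ _ (4 * \sum_w prodw mu w *
    (\sum_i huber 1 `|a i * sc (w i)| * F i w))); last first.
  rewrite ler_wpM2l//; apply: (@le_trans _ _ (\sum_w prodw mu w * (8 * T w))).
    by apply: ler_sum => w _; rewrite ler_wpM2l// /F /T; exact: sum_huber_isolated_le.
  rewrite (eq_bigr (fun w => 8 * (prodw mu w * T w))); last by move=> w _; ring.
  by rewrite -mulr_sumr; move: ET; lra.
rewrite (eq_bigr (fun w => \sum_i prodw mu w * (huber 1 `|a i * sc (w i)| * F i w))); last first.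
  by move=> w _; rewrite mulr_sumr.
rewrite [X in _ <= _ * X]exchange_big/= !mulr_sumr; apply: ler_sum => i _.
rewrite (prodw_indep mu1 (i := i) (fun s => huber 1 `|a i * sc s|)); last first.
  move=> w s; rewrite /F; congr ((_ <= _)%R%:R); apply: eq_bigr => j ji.
  by rewrite ffunE (negPf ji).
rewrite mulrC mulrCA; apply: ler_wpM2l; last exact: F34.
by apply: sumr_ge0 => s _; rewrite mulr_ge0// huber_ge0.
Qed.

End square_function.

(** * Dyadic mixtures equivalent to an Orlicz function *)

Section dyadic.
Context (R : realType).
Implicit Types (M : orliczFun R) (q t : R).

Definition dy k : R := 2^-1 ^+ k.

Lemma dy_gt0 k : 0 < dy k.
Proof. by rewrite exprn_gt0// invr_gt0. Qed.

Lemma dy_le1 k : dy k <= 1.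
Proof. by rewrite exprn_ile1// ?invr_ge0// invf_le1// ler1n. Qed.

Lemma dyD j k : dy (j + k) = dy j * dy k.
Proof. exact: exprD. Qed.

Lemma dyK k : dy k * 2 ^+ k = 1.
Proof. by rewrite /dy -exprMn mulVf// expr1n. Qed.

Lemma dyDK j k : dy (j + k) * 2 ^+ k = dy j.
Proof. by rewrite dyD -mulrA dyK mulr1. Qed.

Lemma dy_le : {homo dy : i j / (i <= j)%N >-> j <= i}.
Proof.
move=> i j ij; rewrite -(subnK ij) dyD.
by apply: ler_piMl; [exact/ltW/dy_gt0|exact: dy_le1].
Qed.

Lemma powR_expn t q k : 0 <= t -> (t ^+ k) `^ q = (t `^ q) ^+ k.
Proof.
move=> t0; elim: k => [|k IH]; first by rewrite !expr0 powR1.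
by rewrite !exprS powRM ?exprn_ge0// IH.
Qed.

Lemma dy_powR q j : dy j `^ q = ((2 `^ q) ^+ j)^-1.
Proof.
rewrite /dy powR_expn ?invr_ge0// -powR_inv1// -powRrM mulrC powRrM.
by rewrite powR_inv1 ?powR_ge0// exprVn.
Qed.

Lemma geometric_le (rho : R) n : 0 <= rho < 1 ->
  \sum_(0 <= k < n) rho ^+ (n - k) <= (1 - rho)^-1.
Proof.
move=> /andP[r0 r1]; have i0 : 0 < 1 - rho by rewrite subr_gt0.
elim: n => [|n IH]; first by rewrite big_geq// invr_ge0 ltW.
rewrite big_nat_recr//= subSnn expr1.
rewrite (eq_big_nat _ _ (F2 := fun k => rho * rho ^+ (n - k))); last first.
  by move=> k /andP[_ kn]; rewrite subSn ?exprS// ltnW.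
rewrite -mulr_sumr; apply: (@le_trans _ _ (rho * (1 - rho)^-1 + rho)).
  by rewrite lerD2r ler_wpM2l.
have -> : rho * (1 - rho)^-1 = (1 - rho)^-1 - 1 by field; rewrite gt_eqF.
by lra.
Qed.

Lemma geometric_leS (rho : R) n : 0 <= rho < 1 ->
  \sum_(0 <= k < n) rho ^+ k.+1 <= (1 - rho)^-1.
Proof.
move=> r01; rewrite big_nat_rev/= add0n; apply: le_trans (geometric_le n r01).
by apply: ler_sum_nat => k /andP[_ kn]; rewrite -subSn.
Qed.

(** The function H_q(t) = E huber_q(t s), before normalization, when s takes the
    value 2^k with weight m k. *)
Definition gauge K (m : nat -> R) q t : R :=
  \sum_(0 <= k < K.+1) m k * huber q (t * 2 ^+ k).

(** The weights m mix the scales so that the gauges with exponents 1 and q are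
    both equivalent to M at the points 2^-l: as huber is increasing in q on
    [1, +oo[, for q >= 1 the two inequalities below bound both gauges from both sides.
    The bound m k <= M (2^-k) keeps the total mass bounded independently of K. *)
Definition dyadic_gauge (M : R -> R) q B K (m : nat -> R) :=
  [/\ forall k, (k <= K)%N -> 0 <= m k <= M (dy k),
      forall l, (l <= K)%N -> M (dy l) <= gauge K m 1 (dy l) &
      forall l, (l <= K)%N -> gauge K m q (dy l) <= B * M (dy l)].

Lemma huber_dy q j : huber q (dy j) = dy j ^+ 2.
Proof. by rewrite huber_le1// dy_le1. Qed.

Lemma huber_pow2 q j : huber q (2 ^+ j) = (2 `^ q) ^+ j.
Proof. by rewrite huber_ge1 ?powR_expn// exprn_ege1// ler1n. Qed.

Lemma orlicz_half M t : 0 <= t -> M (t / 2) <= M t / 2.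
Proof.
move=> t0; rewrite (mulrC t) (mulrC (M t)); apply: orlicz_scale => //.
by apply/andP; split; lra.
Qed.

Lemma dyS k : dy k.+1 = dy k / 2.
Proof. by rewrite /dy exprS mulrC. Qed.

Lemma pow2_gap q r : q < r -> 0 <= (2 : R) `^ q / 2 `^ r < 1.
Proof.
move=> qr; rewrite divr_ge0 ?powR_ge0//= ltr_pdivrMr ?powR_gt0// mul1r.
by rewrite /powR pnatr_eq0/= ltr_expR ltr_pM2r// ln_gt0// ltr1n.
Qed.

(** With G(t) = M(t)/t, the weights satisfy 2^k m k = G(2^-k) - G(2^-(k+1)) for
    k < K and 2^K m K = G(2^-K), so the scales k >= l, where huber 1 is linear,
    telescope to exactly M (2^-l).  They are nonnegative by convexity.  On the
    scales k < l, where huber 1 is quadratic, p-concavity with p < 2 gives a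
    geometric series. *)
Lemma gauge_concave M p K : p < 2 ->
  (forall s t : R, 0 < s -> s <= t -> M t / t `^ p <= M s / s `^ p) ->
  exists m, dyadic_gauge M 1 (1 + (1 - 2 `^ p / 2 `^ 2)^-1) K m.
Proof.
move=> p2 hM; pose m k := if (k < K)%N then M (dy k) - 2 * M (dy k.+1) else M (dy k).
have Mge0 k : 0 <= M (dy k) by rewrite orlicz_ge0// ltW// dy_gt0.
have half k : 2 * M (dy k.+1) <= M (dy k).
  by have := orlicz_half M (ltW (dy_gt0 k)); rewrite dyS; lra.
have m0 k : 0 <= m k <= M (dy k).
  rewrite /m; case: ifP => _; last by rewrite Mge0/=.
  by have := half k; have := Mge0 k.+1; lra.
have tail l : (l <= K)%N ->
    \sum_(l <= k < K.+1) m k * huber 1 (dy l * 2 ^+ k) = M (dy l).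
  move=> lK; transitivity (\sum_(l <= k < K.+1) dy l * (m k * 2 ^+ k)).
    apply: eq_big_nat => k /andP[lk _].
    have e : dy l * 2 ^+ k = 2 ^+ (k - l).
      by rewrite -{1}(subnK lk) exprD mulrCA dyK mulr1.
    by rewrite e huber_pow2 powRr1// -e mulrCA.
  rewrite -mulr_sumr big_nat_recr//=.
  rewrite (eq_big_nat _ _ (F2 := fun k =>
    - (2 ^+ k.+1 * M (dy k.+1)) - (- (2 ^+ k * M (dy k))))); last first.
    by move=> k /andP[_ kK]; rewrite /m kK exprS; ring.
  rewrite telescope_sumr// /m ltnn.
  have -> : - (2 ^+ K * M (dy K)) - - (2 ^+ l * M (dy l)) + M (dy K) * 2 ^+ K =
    2 ^+ l * M (dy l) by ring.
  by rewrite mulrA dyK mul1r.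
have head l : (l <= K)%N ->
    \sum_(0 <= k < l) m k * huber 1 (dy l * 2 ^+ k) <= (1 - 2 `^ p / 2 `^ 2)^-1 * M (dy l).
  move=> lK; apply: (@le_trans _ _ (\sum_(0 <= k < l) (2 `^ p / 2 `^ 2) ^+ (l - k) * M (dy l))).
    apply: ler_sum_nat => k /andP[_ kl]; have kl' := ltnW kl.
    rewrite -{1}(subnK kl') dyDK huber_dy.
    have [_ mk] := andP (m0 k).
    apply: (@le_trans _ _ (M (dy k) * dy (l - k) ^+ 2)).
      by rewrite ler_wpM2r// sqr_ge0.
    have := hM _ _ (dy_gt0 l) (dy_le kl'); rewrite ler_pdivrMr ?powR_gt0 ?dy_gt0//.
    rewrite -mulrA (mulrC _ (_ `^ p)) => h.
    have := ler_wpM2r (sqr_ge0 (dy (l - k))) h; move=> /le_trans; apply.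
    rewrite -(subnK kl') addnK; set j := (l - k)%N.
    have dk0 := dy_gt0 k; have dj0 := dy_gt0 j.
    have pd := dy_powR p j.
    have pk0 : 0 < dy k `^ p by rewrite powR_gt0.
    have p20 : 0 < (2 `^ p : R) ^+ j by rewrite exprn_gt0// powR_gt0.
    rewrite dyD powRM ?(ltW dj0) ?(ltW dk0)// pd powR_mulrn// expr_div_n.
    have -> : dy j ^+ 2 = ((2 ^+ 2) ^+ j)^-1 by rewrite /dy -exprM mulnC exprM !exprVn.
    have p40 : 0 < ((2 : R) ^+ 2) ^+ j by rewrite !exprn_gt0.
    rewrite le_eqVlt; apply/orP; left; apply/eqP; field.
    by rewrite !gt_eqF.
  rewrite -mulr_suml ler_wpM2r//; apply: geometric_le; exact: pow2_gap.
exists m; split=> // [l lK|l lK].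
  rewrite /gauge (@big_cat_nat _ _ _ l)//= ?(leqW lK)// tail// lerDr.
  apply: sumr_ge0 => k _; rewrite mulr_ge0 ?huber_ge0//; by case/andP: (m0 k).
rewrite /gauge (@big_cat_nat _ _ _ l)//= ?(leqW lK)// tail// mulrDl mul1r addrC lerD2l.
exact: head.
Qed.

(** With D(t) = M(t)/t^2, the weights satisfy 4^k m k = D(2^-k) - D(2^-(k-1)) for
    k > 0 and m 0 = M(1), so the scales k <= l, where huber is quadratic for
    every exponent, telescope to exactly M (2^-l).  They are nonnegative by
    2-concavity.  On the scales k > l, where huber q grows like t^q, r-convexity
    with q < r gives a geometric series. *)
Lemma gauge_convex M q r K : 0 <= q -> q < r ->
  (forall s t : R, 0 < s -> s <= t -> M s / s `^ r <= M t / t `^ r) ->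
  (forall s t : R, 0 < s -> s <= t -> M t / t ^+ 2 <= M s / s ^+ 2) ->
  exists m, dyadic_gauge M q (1 + (1 - 2 `^ q / 2 `^ r)^-1) K m.
Proof.
move=> q0 qr hM1 hM2.
pose m k := if k is k'.+1 then M (dy k) - M (dy k') / 4 else M (dy 0).
have Mge0 k : 0 <= M (dy k) by rewrite orlicz_ge0// ltW// dy_gt0.
have quart k : M (dy k) / 4 <= M (dy k.+1).
  have := hM2 _ _ (dy_gt0 k.+1) (dy_le (leqnSn k)); rewrite dyS.
  have -> : (dy k / 2) ^+ 2 = dy k ^+ 2 / 4 by field.
  rewrite ler_pdivrMr ?exprn_gt0 ?dy_gt0// => h; rewrite ler_pdivrMr//.
  apply: le_trans h _; rewrite le_eqVlt; apply/orP; left; apply/eqP; field.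
  by rewrite gt_eqF// dy_gt0.
have m0 k : 0 <= m k <= M (dy k).
  case: k => [|k] /=; first by rewrite Mge0/=.
  by have := quart k; have := Mge0 k; lra.
have head l : \sum_(0 <= k < l.+1) m k * (dy l * 2 ^+ k) ^+ 2 = M (dy l).
  transitivity (dy l ^+ 2 * (\sum_(0 <= k < l.+1) m k * 4 ^+ k)).
    rewrite mulr_sumr; apply: eq_bigr => k _.
    have -> : (4 : R) ^+ k = (2 ^+ k) ^+ 2 by rewrite exprAC; congr (_ ^+ _); ring.
    by ring.
  have -> : \sum_(0 <= k < l.+1) m k * 4 ^+ k = 4 ^+ l * M (dy l).
    elim: l => [|l IH]; first by rewrite big_nat1 /= !expr0 mulr1 mul1r.
    by rewrite big_nat_recr//= IH exprS; field.
  have -> : (4 : R) ^+ l = (2 ^+ l) ^+ 2 by rewrite exprAC; congr (_ ^+ _); ring.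
  by rewrite mulrA -exprMn dyK expr1n mul1r.
have headP s l : (l <= K)%N ->
    \sum_(0 <= k < l.+1) m k * huber s (dy l * 2 ^+ k) = M (dy l).
  move=> lK; rewrite -[RHS]head; apply: eq_big_nat => k /andP[_]; rewrite ltnS => kl.
  by rewrite -(subnK kl) dyDK huber_dy.
have tail l : (l <= K)%N ->
    \sum_(l.+1 <= k < K.+1) m k * huber q (dy l * 2 ^+ k) <=
    (1 - 2 `^ q / 2 `^ r)^-1 * M (dy l).
  move=> lK; rewrite -{1}[l.+1]add0n big_addn subSS.
  apply: (@le_trans _ _ (\sum_(0 <= k < K - l) (2 `^ q / 2 `^ r) ^+ k.+1 * M (dy l))).
    apply: ler_sum_nat => k /andP[_ kl]; set j := k.+1.
    rewrite addnS -addSn -/j.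
    have -> : dy l * 2 ^+ (j + l) = 2 ^+ j by rewrite exprD mulrCA dyK mulr1.
    have [_ mk] := andP (m0 (j + l)%N).
    apply: (@le_trans _ _ (M (dy (j + l)) * huber q (2 ^+ j))).
      by rewrite ler_wpM2r// huber_ge0.
    have := hM1 _ _ (dy_gt0 (j + l)) (dy_le (leq_addl j l)).
    rewrite ler_pdivrMr ?powR_gt0 ?dy_gt0// => h.
    have := ler_wpM2r (huber_ge0 q (2 ^+ j)) h; move=> /le_trans; apply.
    have dl0 := dy_gt0 l.
    have pd := dy_powR r j.
    have pk0 : 0 < dy l `^ r by rewrite powR_gt0.
    have p20 : 0 < (2 `^ r : R) ^+ j by rewrite exprn_gt0// powR_gt0.
    rewrite huber_pow2 dyD powRM ?(ltW (dy_gt0 _))// pd expr_div_n.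
    rewrite le_eqVlt; apply/orP; left; apply/eqP; field.
    by rewrite !gt_eqF.
  rewrite -mulr_suml ler_wpM2r//; apply: geometric_leS; exact: pow2_gap.
exists m; split=> // [l lK|l lK].
  rewrite /gauge (@big_cat_nat _ _ _ l.+1)//= headP// lerDl.
  apply: sumr_ge0 => k _; rewrite mulr_ge0 ?huber_ge0//; by case/andP: (m0 k).
rewrite /gauge (@big_cat_nat _ _ _ l.+1)//= headP// mulrDl mul1r lerD2l.
exact: tail.
Qed.

End dyadic.

(** * Random variables spanning an Orlicz sequence space *)

Section gauge_comparison.
Context (R : realType) (M : orliczFun R) (q B : R) (K : nat) (m : nat -> R).
Hypotheses (q12 : 1 <= q <= 2) (B0 : 0 <= B) (hm : dyadic_gauge M q B K m).
Hypotheses (Mq : forall t, 1 <= t -> t `^ q * M 1 <= M t).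
Hypotheses (M2 : forall t, 0 <= t -> M (2 * t) <= 4 * M t).

Let m0 k : (k <= K)%N -> 0 <= m k.
Proof. by case: hm => + _ _ => /[apply] /andP[]. Qed.

Lemma gauge_ge0 s t : 0 <= gauge K m s t.
Proof.
rewrite /gauge big_nat_cond sumr_ge0// => k /andP[/andP[_ kK] _].
by rewrite mulr_ge0 ?huber_ge0 ?m0.
Qed.

Lemma gauge_le s t u : 0 <= s -> 0 <= t -> t <= u -> gauge K m s t <= gauge K m s u.
Proof.
move=> s0 t0 tu; apply: ler_sum_nat => k /andP[_ kK].
rewrite ler_wpM2l ?m0// huber_le// ?mulr_ge0 ?exprn_ge0//.
by rewrite ler_wpM2r// exprn_ge0.
Qed.

Lemma gauge_double s t : 0 <= s <= 2 -> 0 <= t ->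
  gauge K m s (2 * t) <= 4 * gauge K m s t.
Proof.
move=> s02 t0; rewrite /gauge mulr_sumr; apply: ler_sum_nat => k /andP[_ kK].
by rewrite mulrCA ler_wpM2l ?m0// -mulrA huber_double// mulr_ge0 ?exprn_ge0//.
Qed.

Lemma gauge_scale s t : 1 <= t -> gauge K m s t = t `^ s * gauge K m s 1.
Proof.
move=> t1; rewrite /gauge mulr_sumr; apply: eq_big_nat => k _.
have p2 : (2 ^+ k : R) = 0 \/ 1 <= 2 ^+ k :> R by right; rewrite exprn_ege1// ler1n.
by rewrite mul1r (huber_scale _ t1 p2) mulrCA.
Qed.

Lemma dyadic_locate t : dy R K <= t -> t <= 1 ->
  exists2 l, (l <= K)%N & dy R l <= t <= 2 * dy R l.
Proof.
elim: K => [|k IH] kt t1; first by exists 0%N; rewrite // kt /dy expr0; lra.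
have [/IH/(_ t1)[l lk lt]|/ltW tk] := leP (dy R k) t.
  by exists l => //; exact: leqW.
by exists k.+1 => //; rewrite kt/= dyS; lra.
Qed.

Lemma orlicz_dy k : M (dy R k) <= dy R k * M 1.
Proof.
by rewrite -{1}[dy R k]mulr1 orlicz_scale// dy_le1 ltW// dy_gt0.
Qed.

(** The comparison at dyadic points extends to all t by doubling.  Below 2^-K
    the gauge is no longer comparable to M, but both are at most of order 2^-K,
    an error that is harmless for at most 2^K coordinates. *)
Lemma gauge_upper t : 0 <= t ->
  gauge K m q t <= 4 * B * (M t + dy R K * M 1).
Proof.
case: hm => _ _ hB; have /andP[q1 q2] := q12; have q0 := le_trans ler01 q1.
have d0 := dy_gt0 R; have M1 : 0 < M 1 by exact: orlicz_gt0.
move=> t0; have Mt := orlicz_ge0 M t0.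
have dM : 0 <= dy R K * M 1 by rewrite mulr_ge0// ltW.
have [t1|/ltW t1] := leP t 1; last first.
  have h : gauge K m q 1 <= B * M 1.
    by have := hB 0%N (leq0n _); rewrite /dy expr0.
  rewrite gauge_scale//.
  have := ler_wpM2l (powR_ge0 t q) h; move=> /le_trans; apply.
  rewrite mulrCA -mulrA [leRHS]mulrCA ler_wpM2l//.
  by apply: le_trans (Mq t1) _; lra.
have [tK|/ltW tK] := leP (dy R K) t.
  have [l lK /andP[lt tl]] := dyadic_locate tK t1.
  apply: le_trans (gauge_le q0 t0 tl) _.
  apply: le_trans (gauge_double _ (ltW (d0 l))) _; first by rewrite q0 q2.
  rewrite -mulrA ler_wpM2l//; apply: le_trans (hB _ lK) _.
  rewrite ler_wpM2l//; have := orlicz_le M (ltW (d0 l)) lt; lra.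
apply: le_trans (gauge_le q0 t0 tK) _.
apply: le_trans (hB _ (leqnn K)) _.
rewrite -mulrA mulrCA ler_wpM2l//; have := orlicz_dy K; lra.
Qed.

Lemma gauge_lower t : 0 <= t <= 1 -> M t <= 4 * gauge K m 1 t + dy R K * M 1.
Proof.
case: hm => _ hL _; have d0 := dy_gt0 R.
move=> /andP[t0 t1]; have M1 : 0 < M 1 by exact: orlicz_gt0.
have dM : 0 <= dy R K * M 1 by rewrite mulr_ge0// ltW.
have [tK|/ltW tK] := leP (dy R K) t.
  have [l lK /andP[lt tl]] := dyadic_locate tK t1.
  apply: le_trans (orlicz_le M t0 tl) _.
  apply: le_trans (M2 (ltW (d0 l))) _.
  have := hL _ lK; have := gauge_le ler01 (ltW (d0 l)) lt; lra.
apply: le_trans (orlicz_le M t0 tK) _.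
by have := orlicz_dy K; have := gauge_ge0 1 t; lra.
Qed.

Lemma gauge_mass : \sum_(0 <= k < K.+1) m k <= 2 * M 1.
Proof.
case: hm => h _ _; have M1 : 0 < M 1 by exact: orlicz_gt0.
apply: (@le_trans _ _ (\sum_(0 <= k < K.+1) dy R k * M 1)).
  apply: ler_sum_nat => k /andP[_ kK]; have /andP[_] := h k kK.
  by move=> /le_trans; apply; exact: orlicz_dy.
rewrite -mulr_suml ler_wpM2r ?(ltW M1)//.
have -> : \sum_(0 <= k < K.+1) dy R k = 2 - dy R K.
  elim: K => [|k IH]; first by rewrite big_nat1 /dy expr0; lra.
  by rewrite big_nat_recr//= IH dyS; lra.
by rewrite gerBl ltW// dy_gt0.
Qed.

Lemma gauge_at1 : M 1 <= gauge K m 1 1.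
Proof. by case: hm => _ /(_ 0%N (leq0n _)); rewrite /dy expr0. Qed.

End gauge_comparison.

Section orlicz_system.
Context (R : realType).

(** The span of the y_i in L_1 is isomorphic to the Orlicz space of M, and the
    embedding is also bounded into L_q, uniformly in n when C is.  The upper
    estimate is in modular form, from which the one for norms follows by
    homogeneity. *)
Definition orlicz_system (q C : R) (M : R -> R) n (T : finType)
    (w : T -> R) (y : 'I_n -> T -> R) :=
  [/\ forall t, 0 <= w t, \sum_t w t = 1,
    forall a : 'I_n -> R, \sum_t w t * `|\sum_i a i * y i t| `^ q <=
      C * (1 + \sum_i M `|a i|) &
    forall a : 'rV[R]_n, orlicz_norm M a <=
      C * \sum_t w t * `|\sum_i a 0 i * y i t| ].

(** Normalization by homogeneity.  As F a may vanish, a is divided by a number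
    slightly larger than F a. *)
Lemma orlicz_norm_hom (M : orliczFun R) n (F : 'rV[R]_n -> R) c :
  0 <= c -> (forall a, 0 <= F a) ->
  (forall s a, F (s *: a) = `|s| * F a) ->
  (forall a, F a <= 1 -> orlicz_norm M a <= c) ->
  forall a, orlicz_norm M a <= c * F a.
Proof.
move=> c0 F0 FZ Fc a; apply/ler_addgt0Pr => e e0.
pose u := F a + e / (c + 1); have c1 : 0 < c + 1 by lra.
have d0 : 0 < e / (c + 1) by rewrite divr_gt0.
have u0 : 0 < u by rewrite /u; have := F0 a; lra.
have : orlicz_norm M (u^-1 *: a) <= c.
  apply: Fc; rewrite FZ gtr0_norm ?invr_gt0// mulrC ler_pdivrMr// mul1r.
  by rewrite /u lerDl ltW.
rewrite (@orlicz_normM _ M _ a _ u^-1) ?invr_ge0 ?(ltW u0)//; last first.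
  by move=> i; rewrite mxE normrM gtr0_norm ?invr_gt0.
rewrite ler_pdivrMl// => /le_trans; apply; rewrite /u mulrDl lerD//.
  by rewrite mulrC.
by rewrite mulrAC ler_pdivrMr// ler_wpM2l ?(ltW e0)//; lra.
Qed.

(** The y_i are independent copies of a signed variable with values in the scales
    0 and 1, 2, 4, ..., 2^n.  The weights of a dyadic gauge are divided by 2 M(1) and
    the missing mass is placed at 0, where it does not contribute. *)
Lemma gauge_orlicz_system (M : orliczFun R) q B :
  1 <= q <= 2 -> 0 <= B ->
  (forall t, 1 <= t -> t `^ q * M 1 <= M t) ->
  (forall t, 0 <= t -> M (2 * t) <= 4 * M t) ->
  (forall K, exists m, dyadic_gauge M q B K m) ->
  exists2 C : R, 0 < C & forall n, exists (T : finType) (w : T -> R)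
    (y : 'I_n -> T -> R), orlicz_system q C M w y.
Proof.
move=> q12 B0 Mq M2 hB; have M1 : 0 < M 1 by exact: orlicz_gt0.
pose c := (2 * M 1)^-1; have c0 : 0 < c by rewrite invr_gt0 mulr_gt0.
have cM : c * M 1 = 2^-1 by rewrite /c; field; rewrite gt_eqF.
(* C1 serves the upper estimate.  For the lower one, [square_lower] gives a
   modular at most 11; hence |a_i| <= 22, and after division by 22 the modular
   of M is at most (88 + 1) M(1).  The factor 2 of [khintchine] turns 22 into
   44. *)
pose C1 := 2 + 4 * B + 8 * B * c; pose C2 := 44 * (1 + 89 * M 1).
have Bc : 0 <= B * c by rewrite mulr_ge0// ltW.
have C10 : 0 < C1 by rewrite /C1; lra.
have C20 : 0 < C2 by rewrite /C2; lra.
exists (C1 + C2); first by rewrite addr_gt0.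
move=> n; have [m hm] := hB n.
have ndy : n%:R * dy R n <= 1.
  rewrite mulrC -[leRHS](dyK R n) ler_wpM2l ?(ltW (dy_gt0 _ _))//.
  by rewrite -natrX ler_nat ltnW// ltn_expl.
have m0 k : (k <= n)%N -> 0 <= m k by case: hm => + _ _ => /[apply] /andP[].
(* Index 0 is the scale 0, and index k + 1 is the scale 2^k. *)
pose mun k := if k is k'.+1 then c * m k' else 1 - c * \sum_(0 <= k < n.+1) m k.
pose scn k : R := if k is k'.+1 then 2 ^+ k' else 0.
pose mu (k : 'I_n.+2) := mun k; pose sc (k : 'I_n.+2) := scn k.
have mu_sum : \sum_s mu s = 1.
  rewrite big_ord_recl /mu /= -[X in _ + X]mulr_sumr big_mkord.
  by rewrite subrK.
have mu0 s : 0 <= mu s.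
  rewrite /mu; case: s => -[|k] /= kn; last by rewrite mulr_ge0 ?m0// ltW.
  rewrite subr_ge0 /c mulrC ler_pdivrMr ?mul1r ?mulr_gt0//; exact: gauge_mass hm.
have sc0 s : 0 <= sc s by rewrite /sc; case: s => -[|k] /= _ //; rewrite exprn_ge0.
have muE s t : \sum_k mu k * huber s `|t * sc k| = c * gauge n m s `|t|.
  rewrite big_ord_recl /sc /= mulr0 normr0 huber0 mulr0 add0r /gauge big_mkord.
  rewrite mulr_sumr; apply: eq_bigr => k _; rewrite /mu /= mulrA.
  by rewrite normrM [X in `|_| * X]ger0_norm ?exprn_ge0.
pose T := ({ffun 'I_n -> 'I_n.+2} * {ffun 'I_n -> bool})%type.
pose w (t : T) := prodw mu t.1 * radw R t.2.
pose y i (t : T) := (-1) ^+ (t.2 i) * sc (t.1 i).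
have ySum (f : R -> R) (a : 'I_n -> R) : \sum_t w t * f (\sum_i a i * y i t) =
    \sum_u prodw mu u * \sum_e radw R e * f (radS (fun i => a i * sc (u i)) e).
  under [RHS]eq_bigr do rewrite mulr_sumr.
  rewrite pair_bigA/=; apply: eq_bigr => -[u e] _; rewrite /w /= mulrA.
  by congr (_ * f _); apply: eq_bigr => i _; rewrite /y mulrCA.
have pw0 u : 0 <= prodw mu u by exact: prodw_ge0.
have w0 t : 0 <= w t by rewrite mulr_ge0 ?radw_ge0.
exists T, w, y; split=> //.
- rewrite -(pair_bigA _ (fun u e => prodw mu u * radw R e))/=.
  under eq_bigr do rewrite -mulr_sumr sum_radw mulr1.
  exact: sum_prodw.
- move=> a; rewrite (ySum (fun x => `|x| `^ q)).
  have SM : 0 <= \sum_i M `|a i| by apply: sumr_ge0 => i _; exact: orlicz_ge0.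
  apply: (@le_trans _ _ (2 * (1 + \sum_i c * gauge n m q `|a i|))).
    apply: (@le_trans _ _ (\sum_u prodw mu u *
        (2 * (1 + \sum_i huber q `|a i * sc (u i)|)))).
      by apply: ler_sum => u _; rewrite ler_wpM2l//; exact: rad_upper.
    rewrite (eq_bigr (fun u => 2 * prodw mu u +
        \sum_i 2 * (prodw mu u * huber q `|a i * sc (u i)|))); last first.
      by move=> u _; rewrite -mulr_sumr -mulr_sumr; ring.
    rewrite big_split/= exchange_big/= -mulr_sumr sum_prodw// mulrDr lerD2l.
    rewrite mulr_sumr; apply: ler_sum => i _; rewrite -mulr_sumr.
    by rewrite (prodw_marginal mu_sum i (fun s => huber q `|a i * sc s|)) muE.
  have : \sum_i c * gauge n m q `|a i| <=
      4 * B * c * (\sum_i M `|a i| + n%:R * dy R n * M 1).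
    have -> : \sum_i M `|a i| + n%:R * dy R n * M 1 = \sum_(i < n) (M `|a i| + dy R n * M 1).
      by rewrite big_split/= sumr_const card_ord -mulrA mulr_natl.
    rewrite mulr_sumr; apply: ler_sum => i _; rewrite (mulrC _ c) -mulrA.
    by rewrite ler_wpM2l ?(ltW c0)//; exact: gauge_upper.
  have h1 := ler_wpM2r (ltW M1) ndy; rewrite mul1r in h1.
  set X := \sum_i M _ in SM *; set Y := \sum_i _ => h2.
  have h3 : 4 * B * c * (X + n%:R * dy R n * M 1) <= 4 * B * c * (X + M 1).
    by rewrite ler_wpM2l ?lerD2l// -mulrA mulr_ge0.
  have h4 : 4 * B * c * (X + M 1) = 4 * (B * c) * X + 2 * B.
    by rewrite mulrDr -[_ * c * M 1]mulrA cM; field.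
  have h5 : 0 <= C2 * (1 + X) by rewrite mulr_ge0 ?ltW//; lra.
  have h6 : 0 <= B * X by rewrite mulr_ge0.
  have h7 : C1 * (1 + X) = 2 + 4 * B + 8 * (B * c) + 2 * X + 4 * (B * X) + 8 * (B * c) * X.
    by rewrite /C1; ring.
  rewrite [leRHS]mulrDl h7; have h8 : 0 <= B * c * X by rewrite mulr_ge0.
  by lra.
- pose E (a : 'rV[R]_n) := \sum_t w t * `|\sum_i a 0 i * y i t|.
  have E0 a : 0 <= E a.
    by rewrite /E; apply: sumr_ge0 => t _; rewrite mulr_ge0.
  have EZ s a : E (s *: a) = `|s| * E a.
    rewrite /E mulr_sumr; apply: eq_bigr => t _; rewrite mulrCA -normrM mulr_sumr.
    by congr (_ * `| _ |); apply: eq_bigr => i _; rewrite mxE -mulrA.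
  move=> a; rewrite -/(E a); apply: (@le_trans _ _ (C2 * E a)); last first.
    by rewrite ler_wpM2r// lerDr ltW.
  have -> : C2 * E a = (22 * (1 + 89 * M 1)) * (2 * E a) by rewrite /C2; ring.
  move: a; apply: orlicz_norm_hom => [||s a|a Ea].
  + by lra.
  + by move=> a; rewrite mulr_ge0.
  + by rewrite EZ mulrCA.
  have /(square_lower mu_sum mu0) : \sum_u prodw mu u *
      Num.sqrt (\sum_i (a 0 i * sc (u i)) ^+ 2) <= 1.
    apply: le_trans Ea; rewrite /E (ySum (fun x => `|x|)) mulr_sumr.
    apply: ler_sum => u _; rewrite mulrCA ler_wpM2l//; exact: khintchine.
  under eq_bigr do rewrite muE.
  move=> hs; pose b i := `|a 0 i| / 22.
  have g0 t : 0 <= c * gauge n m 1 t by rewrite mulr_ge0 ?(ltW c0)//; exact: (gauge_ge0 hm).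
  have gi i : c * gauge n m 1 `|a 0 i| <= 11.
    by apply: le_trans hs; rewrite (bigD1 i)//= lerDl; apply: sumr_ge0.
  have b01 i : 0 <= b i <= 1.
    rewrite divr_ge0//= ler_pdivrMr// mul1r.
    have [a1|/ltW a1] := leP `|a 0 i| 1; first by lra.
    have := gi i; rewrite gauge_scale// powRr1// mulrCA.
    have := gauge_at1 hm => h h'.
    have h2 : 2^-1 <= c * gauge n m 1 1 by rewrite -cM ler_wpM2l// ltW.
    have := ler_wpM2l (normr_ge0 (a 0 i)) h2; lra.
  have Mb : \sum_i M (b i) <= 89 * M 1.
    apply: (@le_trans _ _ (\sum_i (8 * M 1 * (c * gauge n m 1 `|a 0 i|) + dy R n * M 1))).
      apply: ler_sum => i _; have /andP[b0 b1] := b01 i.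
      apply: le_trans (gauge_lower hm M2 (b01 i)) _; rewrite lerD2r.
      have -> : 8 * M 1 * (c * gauge n m 1 `|a 0 i|) = 8 * (c * M 1) * gauge n m 1 `|a 0 i| by ring.
      have : gauge n m 1 (b i) <= gauge n m 1 `|a 0 i|.
        apply: (gauge_le hm) => //; rewrite ler_pdivrMr//.
        have := normr_ge0 (a 0 i); lra.
      by rewrite cM; lra.
    rewrite big_split/= -mulr_sumr sumr_const card_ord -[_ *+ n]mulr_natl mulrA.
    have h1 := ler_wpM2r (ltW M1) ndy; rewrite mul1r in h1.
    have h2 : 8 * M 1 * \sum_i c * gauge n m 1 `|a 0 i| <= 8 * M 1 * 11.
      by rewrite ler_wpM2l// mulr_ge0// ltW.
    by lra.
  pose D := 1 + 89 * M 1; have D1 : 1 <= D by rewrite /D; lra.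
  have D0 : 0 < D by lra.
  apply: orlicz_norm_le; split; first by rewrite mulr_gt0.
  apply: (@le_trans _ _ (\sum_i D^-1 * M (b i))).
    apply: ler_sum => i _; have /andP[b0 b1] := b01 i.
    have -> : `|a 0 i| / (22 * D) = D^-1 * b i by rewrite /b; field; rewrite gt_eqF.
    by apply: orlicz_scale; rewrite // invr_ge0 (ltW D0)/= invf_le1.
  rewrite -mulr_sumr ler_pdivrMl// mulr1 (le_trans Mb)// /D; lra.
Qed.

End orlicz_system.

(** * Tensor products *)

Section tensor.
Context (R : realType).
Implicit Types M N : orliczFun R.

Lemma orlicz_norm_le_abs M n (x z : 'rV[R]_n) :
  (forall i, `|z 0 i| <= `|x 0 i|) -> orlicz_norm M z <= orlicz_norm M x.
Proof.
move=> zx; rewrite -[leRHS]addr0 -(@orlicz_norm_eq0 _ M n 0); last by move=> i; rewrite mxE.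
by apply: orlicz_norm_subadd => i; rewrite [X in _ + `|X|]mxE normr0 addr0.
Qed.

Lemma orlicz_norm_mean M n (T : finType) (w : T -> R) (u : T -> 'rV[R]_n) :
  (forall t, 0 <= w t) ->
  orlicz_norm M (\row_i \sum_t w t * `|u t 0 i|) <=
  \sum_t w t * orlicz_norm M (u t).
Proof.
move=> w0; elim: (index_enum T) => [|t s IH].
  by rewrite big_nil orlicz_norm_eq0// => i; rewrite mxE big_nil.
rewrite big_cons -(@orlicz_normM _ M _ (u t) (\row_i (w t * `|u t 0 i|)))//; last first.
  by move=> i; rewrite mxE normrM normr_id ger0_norm.
apply: le_trans (lerD (lexx _) IH); apply: orlicz_norm_subadd => i.
by rewrite !mxE big_cons ler_normD.
Qed.

(** How p-concavity is used: replacing a value v by a random value u costs at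
    most the p-th moment of u / v. *)
Lemma orlicz_concave_growth M p u v : 0 < v -> 0 <= u ->
  (forall s t : R, 0 < s -> s <= t -> M t / t `^ p <= M s / s `^ p) ->
  M u <= M v * (1 + (u / v) `^ p).
Proof.
move=> v0 u0 hM; have Mv : 0 <= M v by rewrite orlicz_ge0// ltW.
have [uv|/ltW vu] := leP u v.
  apply: le_trans (orlicz_le M u0 uv) _.
  by rewrite ler_peMr// lerDl powR_ge0.
have {}u0 : 0 < u by exact: lt_le_trans vu.
have := hM _ _ v0 vu; rewrite ler_pdivrMr ?powR_gt0// => /le_trans; apply.
rewrite -{1}[u](divfK (lt0r_neq0 v0)) powRM ?divr_ge0 ?(ltW u0) ?(ltW v0)//.
rewrite mulrCA divfK ?gt_eqF ?powR_gt0// mulrC ler_wpM2l//.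
by rewrite lerDr.
Qed.

(** The L_1 norm of sum_ij A_ij y_i (x) x_j on the product of the two
    probability spaces. *)
Definition tensor_mean n (T U : finType) (w : T -> R) (y : 'I_n -> T -> R)
    (w' : U -> R) (x : 'I_n -> U -> R) (A : 'M[R]_n) : R :=
  \sum_u w' u * \sum_t w t * `|\sum_i (\sum_j A i j * x j u) * y i t|.

Variables (M N : orliczFun R) (p C1 C2 : R) (n : nat) (T U : finType).
Variables (w : T -> R) (y : 'I_n -> T -> R) (w' : U -> R) (x : 'I_n -> U -> R).
Hypotheses (C10 : 0 < C1) (C20 : 0 < C2).
Hypotheses (hM : orlicz_system 1 C1 M w y) (hN : orlicz_system p C2 N w' x).

(** The lower estimates of the two systems are chained by the triangle inequality
    for the norm of M, in the form of [orlicz_norm_mean]. *)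
Lemma tensor_lower (A : orlicz_mx M N n) :
  orlicz_mx_norm A <= C1 * C2 * tensor_mean w y w' x A.
Proof.
case: hM hN => w0 w1 _ lM [w'0 w'1 _ lN].
pose f u : 'rV[R]_n := \row_i \sum_j (A : 'M[R]_n) i j * x j u.
rewrite /orlicz_mx_norm.
apply: (@le_trans _ _ (C2 * orlicz_norm M (\row_i \sum_u w' u * `|f u 0 i|))).
  rewrite -(@orlicz_normM _ M _ (\row_i \sum_u w' u * `|f u 0 i|)
    (C2 *: \row_i \sum_u w' u * `|f u 0 i|)) ?(ltW C20)//; last first.
    by move=> i; rewrite mxE normrM gtr0_norm.
  apply: orlicz_norm_le_abs => i; rewrite !mxE ger0_norm ?orlicz_norm_ge0//.
  apply: le_trans (lN _) _; apply: le_trans (ler_norm _).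
  rewrite ler_wpM2l ?(ltW C20)//; apply: ler_sum => u _.
  rewrite ler_wpM2l// le_eqVlt; apply/orP; left; apply/eqP.
  by rewrite mxE; congr `| _ |; apply: eq_bigr => j _; rewrite mxE.
rewrite (mulrC C1) -mulrA ler_wpM2l ?(ltW C20)//.
apply: le_trans (orlicz_norm_mean _ _ w'0) _.
rewrite /tensor_mean mulr_sumr; apply: ler_sum => u _.
rewrite mulrCA ler_wpM2l//; apply: le_trans (lM _) _.
rewrite ler_wpM2l ?(ltW C10)//; apply: ler_sum => t _.
rewrite ler_wpM2l// le_eqVlt; apply/orP; left; apply/eqP.
by congr `| _ |; apply: eq_bigr => i _; rewrite mxE.
Qed.

Hypothesis hp : forall s t : R, 0 < s -> s <= t -> M t / t `^ p <= M s / s `^ p.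
Hypothesis M2 : forall t, 0 <= t -> M (2 * t) <= 4 * M t.

(** [orlicz_concave_growth] around v = 2 ||a||_N; the factor 2 ensures that a / v
    lies in the ball of N without discussing whether the infimum defining the
    norm is attained, so that the p-th moment of the sum divided by v is bounded. *)
Lemma orlicz_row_mean (a : 'rV[R]_n) :
  \sum_u w' u * M `|\sum_j a 0 j * x j u| <=
  4 * (1 + 2 * C2) * M (orlicz_norm N a).
Proof.
case: hN => w'0 w'1 uN _; set b := orlicz_norm N a.
have b0 : 0 <= b by exact: orlicz_norm_ge0.
have [bE|bN0] := eqVneq b 0.
  rewrite big1 ?bE ?orlicz_eq0 ?mulr0// => u _.
  rewrite big1 ?normr0 ?orlicz_eq0 ?mulr0// => j _.
  by rewrite (orlicz_norm0_eq0 bE) mul0r.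
have bgt0 : 0 < b by rewrite lt0r bN0.
have v0 : 0 < 2 * b by rewrite mulr_gt0.
have [_ vball] : 0 < 2 * b /\ \sum_(i < n) N (`|a 0 i| / (2 * b)) <= 1.
  by apply: orlicz_norm_lt; rewrite -/b; lra.
pose S := \sum_u w' u * `|\sum_j (a 0 j / (2 * b)) * x j u| `^ p.
have S2 : S <= 2 * C2.
  apply: le_trans (uN _) _; rewrite mulrC ler_wpM2r ?(ltW C20)//.
  rewrite -[2]/(1 + 1) lerD2l; under eq_bigr do rewrite normrM normfV (gtr0_norm v0).
  exact: vball.
apply: (@le_trans _ _ (M (2 * b) * (1 + S))).
  have -> : M (2 * b) * (1 + S) = \sum_u w' u *
      (M (2 * b) * (1 + `|\sum_j (a 0 j / (2 * b)) * x j u| `^ p)).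
    transitivity (\sum_u (M (2 * b) * w' u +
        M (2 * b) * (w' u * `|\sum_j (a 0 j / (2 * b)) * x j u| `^ p))).
      by rewrite big_split/= -!mulr_sumr w'1 /S; ring.
    by apply: eq_bigr => u _; ring.
  apply: ler_sum => u _; rewrite ler_wpM2l//.
  have -> : `|\sum_j (a 0 j / (2 * b)) * x j u| = `|\sum_j a 0 j * x j u| / (2 * b).
    have -> : \sum_j (a 0 j / (2 * b)) * x j u = (\sum_j a 0 j * x j u) / (2 * b).
      by rewrite mulr_suml; apply: eq_bigr => j _; rewrite mulrAC.
    by rewrite normrM normfV (gtr0_norm v0).
  exact: orlicz_concave_growth.
have Mb := M2 b0; have Mb0 : 0 <= M b by exact: orlicz_ge0.
apply: (@le_trans _ _ ((4 * M b) * (1 + 2 * C2))); last by rewrite le_eqVlt mulrAC eqxx.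
apply: ler_pM => //; first by rewrite orlicz_ge0// ltW.
  by rewrite addr_ge0// sumr_ge0// => u _; rewrite mulr_ge0 ?powR_ge0.
by rewrite lerD2l.
Qed.

Lemma tensor_upper (A : orlicz_mx M N n) :
  tensor_mean w y w' x A <= C1 * (1 + 4 * (1 + 2 * C2)) * orlicz_mx_norm A.
Proof.
case: hM => w0 w1 uM _; case: (hN) => w'0 w'1 _ _.
set D := C1 * _; have D0 : 0 < D.
  by rewrite mulr_gt0// addr_gt0// mulr_gt0// addr_gt0// mulr_gt0.
have unit (B : 'M[R]_n) : \sum_i M (orlicz_norm N (row i B)) <= 1 ->
    tensor_mean w y w' x B <= D.
  move=> hB; apply: (@le_trans _ _ (\sum_u w' u *
      (C1 * (1 + \sum_i M `|\sum_j B i j * x j u|)))).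
    apply: ler_sum => u _; rewrite ler_wpM2l//.
    have := uM (fun i => \sum_j B i j * x j u).
    by under eq_bigr do rewrite powRr1//.
  have -> : \sum_u w' u * (C1 * (1 + \sum_i M `|\sum_j B i j * x j u|)) =
      C1 * (1 + \sum_i \sum_u w' u * M `|\sum_j B i j * x j u|).
    transitivity (\sum_u (C1 * w' u +
        C1 * (\sum_i w' u * M `|\sum_j B i j * x j u|))).
      by apply: eq_bigr => u _; rewrite -mulr_sumr; ring.
    by rewrite big_split/= -!mulr_sumr w'1 exchange_big/=; ring.
  rewrite ler_wpM2l ?(ltW C10)// lerD2l.
  apply: (@le_trans _ _ (\sum_i 4 * (1 + 2 * C2) * M (orlicz_norm N (row i B)))).
    apply: ler_sum => i _; apply: le_trans (orlicz_row_mean (row i B)).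
    rewrite le_eqVlt; apply/orP; left; apply/eqP; apply: eq_bigr => u _.
    by congr (_ * M `| _ |); apply: eq_bigr => j _; rewrite mxE.
  by rewrite -mulr_sumr ler_piMr// mulr_ge0//; have := C20; lra.
have tensorZ (s : R) (B : 'M[R]_n) : 0 <= s ->
    tensor_mean w y w' x (s *: B) = s * tensor_mean w y w' x B.
  move=> s0; rewrite /tensor_mean mulr_sumr; apply: eq_bigr => u _.
  rewrite mulrCA; congr (_ * _); rewrite mulr_sumr; apply: eq_bigr => t _.
  have -> : \sum_i (\sum_j (s *: B) i j * x j u) * y i t =
      s * \sum_i (\sum_j B i j * x j u) * y i t.
    rewrite mulr_sumr; apply: eq_bigr => i _; rewrite mulrA mulr_sumr.
    by congr (_ * _); apply: eq_bigr => j _; rewrite mxE mulrA.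
  by rewrite normrM ger0_norm// mulrCA.
apply/ler_addgt0Pr => e e0; set v := orlicz_mx_norm A.
have v0 : 0 <= v by exact: orlicz_norm_ge0.
pose r := v + e / D; have eD : 0 < e / D by rewrite divr_gt0.
have r0 : 0 < r by rewrite /r; lra.
have [_ rball] : 0 < r /\ \sum_(i < n)
    M (`|(\row_i orlicz_norm N (row i (A : 'M[R]_n))) 0 i| / r) <= 1.
  by apply: orlicz_norm_lt; rewrite -/(orlicz_mx_norm A) -/v /r; lra.
have : tensor_mean w y w' x (r^-1 *: (A : 'M[R]_n)) <= D.
  apply: unit; apply: le_trans rball; apply: ler_sum => i _.
  rewrite mxE ger0_norm ?orlicz_norm_ge0//.
  rewrite (@orlicz_normM _ N _ (row i (A : 'M[R]_n)) _ r^-1) ?invr_ge0 ?(ltW r0)//.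
    by rewrite mulrC.
  by move=> j; rewrite !mxE normrM gtr0_norm ?invr_gt0.
rewrite tensorZ ?invr_ge0 ?(ltW r0)// ler_pdivrMl// => /le_trans; apply.
by rewrite /r mulrDl divfK ?gt_eqF// mulrC.
Qed.

End tensor.

(** * Finite-dimensional l_1 inside L_1 *)

Section L1_steps.
Context (R : realType) (T : finType).

Let mu : {measure set (measurableTypeR R) -> \bar R} :=
  mrestr (@lebesgue_measure R) (measurable_itv `[0 : R, 1 : R]).

Let m : R := #|T|%:R.

(* The cells cut [0, 1[ into #|T| intervals of equal length. *)
Let cell (t : T) : set (measurableTypeR R) :=
  [set` `[(enum_rank t)%:R / m, (enum_rank t).+1%:R / m[].

Let m_gt0 (t : T) : 0 < m.
Proof. by rewrite ltr0n; apply/card_gt0P; exists t. Qed.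

Let measurable_cell t : measurable (cell t).
Proof. exact: measurable_itv. Qed.

Let mu_cell t : mu (cell t) = (m^-1)%:E.
Proof.
have m0 := m_gt0 t.
rewrite /mu /= /mrestr /= setIidl; last first.
  move=> x; rewrite /cell /= !in_itv/= => /andP[h1 h2]; apply/andP; split.
    by apply: le_trans h1; rewrite divr_ge0// ltW.
  apply: le_trans (ltW h2) _; rewrite ler_pdivrMr// mul1r ler_nat.
  exact: ltn_ord.
rewrite /cell lebesgue_measure_itv/= lte_fin ltr_pM2r ?invr_gt0// ltr_nat ltnSn.
by rewrite -EFinB -mulrBl -natrB// subSnn mul1r.
Qed.

Let cell_inj s t x : cell s x -> cell t x -> s = t.
Proof.
have m0 := m_gt0 s.
rewrite /cell /= !in_itv/= !ler_pdivrMr// !ltr_pdivlMr// => /andP[s1 s2] /andP[t1 t2].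
apply/enum_rank_inj/val_inj/eqP; rewrite eqn_leq.
have := le_lt_trans s1 t2; have := le_lt_trans t1 s2.
by rewrite !ltr_nat !ltnS => -> ->.
Qed.

(* Normalized so as to have integral 1. *)
Let step (t : T) (x : measurableTypeR R) : R := m * \1_(cell t) x.

Let measurable_step t : measurable_fun setT (step t).
Proof. by apply: measurable_funM => //; exact: measurable_indic. Qed.

Let step_ge0 t x : 0 <= step t x.
Proof. by rewrite mulr_ge0// ltW// m_gt0. Qed.

Let integral_step t : (\int[mu]_x (step t x)%:E = 1)%E.
Proof.
under eq_integral do rewrite EFinM.
rewrite ge0_integralZl_EFin ?(ltW (m_gt0 t))//; last first.
- by apply/measurable_EFinP; exact: measurable_indic.
by rewrite integral_indic// setIT mu_cell -EFinM divff// gt_eqF// m_gt0.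
Qed.

Let step_Lfun t : step t \in Lfun mu 1.
Proof.
apply/Lfun1_integrable/integrableP; split; first exact/measurable_EFinP.
rewrite (eq_integral (fun x => (step t x)%:E)) ?integral_step ?ltry//.
by move=> x _ /=; rewrite ger0_norm.
Qed.

Let norm_sum_step (c : T -> R) x :
  `|\sum_t c t * step t x| = \sum_t `|c t| * step t x.
Proof.
have [[t tx]|none] := pselect (exists t, cell t x).
  have other s : s != t -> step s x = 0.
    move=> st; rewrite /step indicE memNset ?mulr0// => sx.
    by rewrite (cell_inj sx tx) eqxx in st.
  rewrite (bigD1 t)//= [RHS](bigD1 t)//= !big1 ?addr0.
  - by rewrite normrM (ger0_norm (step_ge0 _ _)).
  - by move=> s /other ->; rewrite mulr0.
  - by move=> s /other ->; rewrite mulr0.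
have zero t : step t x = 0.
  by rewrite /step indicE memNset ?mulr0// => tx; apply: none; exists t.
by rewrite !big1 ?normr0// => t _; rewrite zero mulr0.
Qed.

(** The steps have disjoint supports, hence the absolute value of a combination
    is the combination of the absolute values of the coefficients. *)
Lemma L1_contains_l1 : exists e : T -> L1 R,
  forall c : T -> R, `|\sum_t c t *: e t| = \sum_t `|c t|.
Proof.
pose e t : L1 R := to_Lspace (Lfun_Sub (lexx 1%E) (step_Lfun t)).
exists e => c.
have ae : \forall x \ae mu, (\sum_t c t *: e t : L1 R) x = \sum_t c t * step t x.
  elim: (index_enum T) => [|t s IH].
    rewrite big_nil; apply: filterS (Lspace_zeroE mu (lexx 1%E)) => x ->.
    by rewrite big_nil.
  rewrite big_cons; near=> x; rewrite big_cons.
  rewrite (near (Lspace_addE (c t *: e t) (\sum_(j <- s) c j *: e j)) x)//.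
  rewrite (near (Lspace_scaleE (c t) (e t)) x)// (near IH x)//.
  by rewrite (near (to_LspaceE (Lfun_Sub (lexx 1%E) (step_Lfun t))) x).
have msum : measurable_fun setT (fun x => \sum_t c t * step t x).
  by apply: measurable_sum => t; apply: measurable_funM.
rewrite [LHS](_ : _ = fine (\int[mu]_x (`|\sum_t c t * step t x|)%:E)%E); last first.
  transitivity (fine 'N[mu]_1[EFin \o (fun x => (\sum_t c t * step t x)%R)]%E).
    rewrite -[LHS]/(Lspace_norm _) /Lspace_norm; congr fine.
    by apply: eq_ae_Lnorm => //; exact: Lspace_measurable.
  by rewrite Lnorm1.
under eq_integral do rewrite norm_sum_step -sumEFin.
rewrite ge0_integral_sum//; last 2 first.
- move=> t; apply/measurable_EFinP; exact: measurable_funM.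
- by move=> t x _; rewrite lee_fin mulr_ge0.
under eq_bigr => t _.
  under eq_integral do rewrite EFinM.
  rewrite ge0_integralZl_EFin//; last 2 first.
    by move=> x _; rewrite lee_fin.
    exact/measurable_EFinP.
  rewrite integral_step mule1.
  over.
by rewrite sumEFin.
Unshelve. all: by end_near. Qed.

End L1_steps.

(** * Banach-Mazur distance to the range of an embedding *)

Section linear_image.
Context (R : realType) (X V : normedModType R) (Phi : {linear X -> V}).

Definition linear_image : {pred V} := fun v => `[< exists x, Phi x = v >].

Lemma linear_imageP v : reflect (exists x, Phi x = v) (v \in linear_image).
Proof. exact: asboolP. Qed.

Lemma linear_image_submod_closed : submod_closed linear_image.
Proof.
split; first by apply/linear_imageP; exists 0; rewrite linear0.
move=> a u v /linear_imageP[x <-] /linear_imageP[y <-].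
by apply/linear_imageP; exists (a *: x + y); rewrite linearP.
Qed.

HB.instance Definition _ :=
  GRing.isSubmodClosed.Build R V linear_image linear_image_submod_closed.

Local Notation E := (linear_subspace linear_image).

Lemma mem_linear_image x : Phi x \in linear_image.
Proof. by apply/linear_imageP; exists x. Qed.

Definition to_image (x : X) : E := exist _ (Phi x) (mem_linear_image x).

Lemma to_image_linear : linear to_image.
Proof. by move=> a x y; apply: val_inj; rewrite /= linearP. Qed.

HB.instance Definition _ := GRing.isLinear.Build R X E _ to_image to_image_linear.

Definition of_image (z : E) : X := projT1 (cid (elimT (linear_imageP _) (valP z))).

Lemma of_imageK z : Phi (of_image z) = val z.
Proof. by rewrite /of_image; case: cid. Qed.

Lemma opnorm_le (Y Z : normedModType R) (f : Y -> Z) c : 0 <= c ->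
  (forall y, `|f y| <= c * `|y|) -> (opnorm f <= c%:E)%E.
Proof.
move=> c0 fc; apply: ub_ereal_sup => _ [y /= y1 <-]; rewrite lee_fin.
by apply: le_trans (fc y) _; rewrite ler_piMr.
Qed.

Lemma opnorm_ge0 (Y Z : normedModType R) (f : {linear Y -> Z}) : (0 <= opnorm f)%E.
Proof.
apply: ereal_sup_ubound; by exists 0; rewrite /= ?linear0 normr0.
Qed.

Lemma linear_le_continuous (Y Z : normedModType R) (f : {linear Y -> Z}) c :
  (forall y, `|f y| <= c * `|y|) -> continuous f.
Proof.
move=> fc; apply: bounded_linear_continuous; apply/linear_boundedP.
near=> r => y; apply: le_trans (fc y) _; rewrite ler_wpM2r//.
Unshelve. all: by end_near. Qed.

Lemma has_dim_linear_iso (Y Z : lmodType R) (f : {linear Y -> Z}) g d :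
  cancel f g -> cancel g f -> has_dim Y d -> has_dim Z d.
Proof.
move=> fK gK [b hb]; exists (f \o b) => z.
have [c [cE cU]] := hb (g z); exists c; split.
  by rewrite -[LHS]gK cE linear_sum; apply: eq_bigr => i _; rewrite linearZ.
move=> c' c'E; apply: cU; apply: (can_inj fK); rewrite gK c'E linear_sum.
by apply: eq_bigr => i _; rewrite linearZ.
Qed.

Variables (a b : R) (d : nat).
Hypotheses (a0 : 0 <= a) (b0 : 0 <= b).
Hypothesis Phi_lower : forall x, `|x| <= a * `|Phi x|.
Hypothesis Phi_upper : forall x, `|Phi x| <= b * `|x|.

Lemma bilipschitz_inj : injective Phi.
Proof.
move=> x y xy; apply/eqP; rewrite -subr_eq0 -normr_le0.
by apply: le_trans (Phi_lower _) _; rewrite linearB xy subrr normr0 mulr0.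
Qed.

Lemma to_imageK : cancel to_image of_image.
Proof. by move=> x; apply: bilipschitz_inj; rewrite of_imageK. Qed.

Lemma of_imageK' : cancel of_image to_image.
Proof. by move=> z; apply: val_inj; rewrite /= of_imageK. Qed.

Lemma of_image_linear : linear of_image.
Proof. exact: can2_linear to_imageK of_imageK'. Qed.

HB.instance Definition _ := GRing.isLinear.Build R E X _ of_image of_image_linear.

(** A two-sided norm estimate makes the map an isomorphism onto its range, at
    distance at most the product of the two constants. *)
Lemma banach_mazur_image : has_dim X d ->
  exists F : submodClosed V, has_dim (linear_subspace F) d /\
    (banach_mazur (linear_subspace F) X <= (a * b)%:E)%E.
Proof.
move=> dX; pose F : submodClosed V := linear_image; exists F; split.
  exact: has_dim_linear_iso to_imageK of_imageK' dX.
have ofa z : `|of_image z| <= a * `|z|.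
  by apply: le_trans (Phi_lower _) _; rewrite of_imageK.
have tob x : `|to_image x| <= b * `|x| by exact: Phi_upper.
apply: (@le_trans _ _ (opnorm of_image * opnorm to_image)%E).
  apply: ereal_inf_lbound.
  exists of_image, to_image; split => //.
  - exact: of_imageK'.
  - exact: to_imageK.
  - exact: linear_le_continuous ofa.
  - exact: linear_le_continuous tob.
by rewrite EFinM lee_pmul ?opnorm_ge0// opnorm_le.
Qed.

End linear_image.

(** * The embedding theorem *)

Section orlicz_facts.
Context (R : realType).

Lemma orlicz_mx_dim (M N : orliczFun R) n : has_dim (orlicz_mx M N n) (n ^ 2).
Proof.
suff : has_dim ('M[R]_n : lmodType R) (n * n) by [].
exists (fun k => vec_mx (delta_mx 0 k)) => A.
have decomp (c : {ffun 'I_(n * n) -> R}) :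
    \sum_k c k *: vec_mx (delta_mx 0 k) = vec_mx (\row_k c k) :> 'M[R]_n.
  rewrite [\row_k c k]row_sum_delta linear_sum; apply: eq_bigr => k _.
  by rewrite linearZ mxE.
exists [ffun k => mxvec A 0 k]; split.
  rewrite decomp -[LHS]mxvecK; congr vec_mx; apply/rowP => k.
  by rewrite mxE ffunE.
move=> c; rewrite decomp => ->; apply/ffunP => k.
by rewrite ffunE vec_mxK mxE.
Qed.

Lemma orlicz_ge_linear (M : orliczFun R) t : 1 <= t -> t * M 1 <= M t.
Proof.
move=> t1; have t0 : 0 < t by lra.
rewrite mulrC -ler_pdivlMr//.
have := @orlicz_scale _ M t^-1 t _ (ltW t0).
rewrite mulVf ?gt_eqF// mulrC; apply.
by rewrite invr_ge0 (ltW t0) invf_le1.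
Qed.

Lemma orlicz_double (M : orliczFun R) q t : q <= 2 ->
  (forall s t : R, 0 < s -> s <= t -> M t / t `^ q <= M s / s `^ q) ->
  0 <= t -> M (2 * t) <= 4 * M t.
Proof.
move=> q2 hM; rewrite le_eqVlt => /predU1P[<-|t0].
  by rewrite mulr0 orlicz_eq0 mulr0.
have h2 : t <= 2 * t by lra.
have := hM _ _ t0 h2; rewrite ler_pdivrMr ?powR_gt0 ?mulr_gt0// => /le_trans; apply.
rewrite powRM ?(ltW t0)// mulrCA divfK ?gt_eqF ?powR_gt0//.
rewrite ler_wpM2r ?orlicz_ge0 ?(ltW t0)//.
have -> : (4 : R) = 2 `^ 2%:R by rewrite powR_mulrn//; ring.
by rewrite ler_powR// ler1n.
Qed.

End orlicz_facts.

Theorem theorem1p1 (R : realType) (p r : R) (M N : orliczFun R)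
    (hp : 1 < p) (hpr : p < r) (hr : r < 2)
    (hM : forall s t : R, 0 < s -> s <= t -> M t / t `^ p <= M s / s `^ p)
    (hN1 : forall s t : R, 0 < s -> s <= t -> N s / s `^ r <= N t / t `^ r)
    (hN2 : forall s t : R, 0 < s -> s <= t -> N t / t ^+ 2 <= N s / s ^+ 2) :
  exists2 C : R, 0 < C &
    forall n : nat, exists E : submodClosed (L1 R),
      has_dim (linear_subspace E) (n ^ 2)%N /\
      (banach_mazur (linear_subspace E) (orlicz_mx M N n) <= C%:E)%E.
Proof.
have M2 t : 0 <= t -> M (2 * t) <= 4 * M t by apply: (orlicz_double (q := p)) => //; lra.
have N2 t : 0 <= t -> N (2 * t) <= 4 * N t.
  apply: (orlicz_double (q := 2%:R)) => // s u s0 su.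
  by rewrite !powR_mulrn ?hN2//; lra.
have B0 (s u : R) : s < u -> 0 <= 1 + (1 - 2 `^ s / 2 `^ u)^-1.
  by move=> /(@pow2_gap R) /andP[_ h]; rewrite addr_ge0// invr_ge0 subr_ge0 ltW.
have [C1 C10 sysM] : exists2 C : R, 0 < C & forall n, exists (T : finType) (w : T -> R)
    (y : 'I_n -> T -> R), orlicz_system 1 C M w y.
  apply: (gauge_orlicz_system (B := 1 + (1 - 2 `^ p / 2 `^ 2)^-1)) => //.
  - by apply/andP; split; lra.
  - by apply: B0; lra.
  - by move=> t t1; rewrite powRr1 ?orlicz_ge_linear//; lra.
  - by move=> K; apply: gauge_concave => //; lra.
have [C2 C20 sysN] : exists2 C : R, 0 < C & forall n, exists (T : finType) (w : T -> R)
    (y : 'I_n -> T -> R), orlicz_system p C N w y.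
  apply: (gauge_orlicz_system (B := 1 + (1 - 2 `^ p / 2 `^ r)^-1)) => //.
  - by apply/andP; split; lra.
  - exact: B0.
  - move=> t t1; have t0 : 0 < t by lra.
    have := hN1 _ _ ltr01 t1; rewrite powR1 divr1 ler_pdivlMr ?powR_gt0//.
    apply: le_trans; rewrite mulrC ler_wpM2l ?orlicz_ge0//.
    by rewrite ler_powR// ltW.
  - by move=> K; apply: gauge_convex => //; lra.
pose D := C1 * (1 + 4 * (1 + 2 * C2)).
have D0 : 0 < D by rewrite mulr_gt0// addr_gt0// mulr_gt0// addr_gt0// mulr_gt0.
exists (C1 * C2 * D); first by apply: mulr_gt0 => //; exact: mulr_gt0.
move=> n; have [T [w [y sM]]] := sysM n; have [U [w' [x sN]]] := sysN n.
have [e eE] := L1_contains_l1 R (T * U)%type.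
pose f (tu : T * U) (A : orlicz_mx M N n) : R := w tu.1 * w' tu.2 *
  \sum_i (\sum_j (A : 'M[R]_n) i j * x j tu.2) * y i tu.1.
pose Phi (A : orlicz_mx M N n) : L1 R := \sum_tu f tu A *: e tu.
have PhiE A : `|Phi A| = tensor_mean w y w' x A.
  rewrite /Phi eE /tensor_mean; case: sM sN => w0 _ _ _ [w'0 _ _ _].
  under [RHS]eq_bigr do rewrite mulr_sumr.
  rewrite exchange_big pair_bigA; apply: eq_bigr => -[t u] _ /=.
  by rewrite /f !normrM /= (ger0_norm (w0 t)) (ger0_norm (w'0 u)) [RHS]mulrCA mulrA.
have fP tu (a : R) (A B : orlicz_mx M N n) : f tu (a *: A + B) = a * f tu A + f tu B.
  rewrite /f mulrCA -mulrDr; congr (_ * _); rewrite mulr_sumr -big_split/=.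
  apply: eq_bigr => i _; rewrite mulrA -mulrDl; congr (_ * _).
  rewrite mulr_sumr -big_split/=; apply: eq_bigr => j _.
  by rewrite !mxE mulrDl mulrA.
have Phi_linear : linear Phi.
  move=> a A B; rewrite /Phi scaler_sumr -big_split/=; apply: eq_bigr => tu _.
  by rewrite fP scalerDl scalerA.
pose PhiL : {linear orlicz_mx M N n -> L1 R} :=
  HB.pack Phi (GRing.isLinear.Build R (orlicz_mx M N n) (L1 R) _ Phi Phi_linear).
apply: (@banach_mazur_image _ _ _ PhiL (C1 * C2) D).
- by rewrite mulr_ge0// ltW.
- exact: ltW.
- by move=> A; rewrite [X in _ * X]PhiE; exact: tensor_lower sM sN _.
- by move=> A; rewrite [leLHS]PhiE; exact: tensor_upper sM sN hM M2 _.
- exact: orlicz_mx_dim.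
Qed.
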